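(* Let $\mathcal{A}$ and $\mathcal{B}$ be the categories of the free adjunction generated by $(\emptyset,\{\emptyset\})$, and let $\mathcal{D}_{\mathcal{A}}$ and $\mathcal{D}_{\mathcal{B}}$ be the categories of friezes of finite type with, respectively, odd natural numbers and even natural numbers as objects. Then $E_{\mathcal{A}}$ is an isomorphism of categories from $\mathcal{A}$ to $\mathcal{D}_{\mathcal{A}}$, and $E_{\mathcal{B}}$ is an isomorphism of categories from $\mathcal{B}$ to $\mathcal{D}_{\mathcal{B}}$.
   Context: Free adjunction generated by $(\emptyset,\{\emptyset\})$. The objects of $\mathcal{B}$ are the words $(GF)^n\emptyset$, $n\ge 0$; the objects of $\mathcal{A}$ are the words $F(GF)^n\emptyset$, $n\ge 0$. Below $a,a_1,\ldots$ denote objects of $\mathcal{A}$ and $b,b_1,\ldots$ objects of $\mathcal{B}$; $Fb$ and $Ga$ denote the words obtained by prefixing. The (arrow) terms, with types, are defined inductively: $\mathbf{1}_a:a\to a$ is a term of $\mathcal{A}$ and $\mathbf{1}_b:b\to b$ a term of $\mathcal{B}$; composable terms $f_1,f_2$ of $\mathcal{A}$ give a term $f_2\circ f_1$ of $\mathcal{A}$, and similarly in $\mathcal{B}$; if $g:b_1\to b_2$ is a term of $\mathcal{B}$, then $Fg:Fb_1\to Fb_2$ is a term of $\mathcal{A}$ and $\gamma^{c}g:b_1\to GFb_2$ is a term of $\mathcal{B}$; if $f:a_1\to a_2$ is a term of $\mathcal{A}$, then $Gf:Ga_1\to Ga_2$ is a term of $\mathcal{B}$ and $\varphi^{a}f:FGa_1\to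 a_2$ is a term of $\mathcal{A}$. Equality of terms in $\mathcal{A}$ and $\mathcal{B}$ is the smallest congruence satisfying, whenever both sides are defined: the category equations (units and associativity); $F\mathbf{1}_b=\mathbf{1}_{Fb}$, $G\mathbf{1}_a=\mathbf{1}_{Ga}$; $Fg_2\circ Fg_1=F(g_2\circ g_1)$, $Gf_2\circ Gf_1=G(f_2\circ f_1)$; $f_2\circ\varphi^{a}f_1=\varphi^{a}(f_2\circ f_1)$, $\gamma^{c}g_2\circ g_1=\gamma^{c}(g_2\circ g_1)$; $\varphi^{a}f_2\circ FGf_1=\varphi^{a}(f_2\circ f_1)$, $GFg_2\circ\gamma^{c}g_1=\gamma^{c}(g_2\circ g_1)$; $\varphi^{a}f\circ F\gamma^{c}g=f\circ Fg$, $G\varphi^{a}f\circ\gamma^{c}g=Gf\circ g$. The arrows of $\mathcal{A}$ and $\mathcal{B}$ are the equivalence classes of terms. Friezes. $\mathbb{N}$ includes $0$; $\mathbb{N}^+=\mathbb{N}\setminus\{0\}$. A segment $[a,b]$ with $a<b$ in $\mathbb{Z}\setminus\{0\}$ is $\{z\in\mathbb{Z}\setminus\{0\}\mid a\le z\le b\}$, with end points $a,b$. $[a,b]$ encloses $[c,d]$ when $a<c$ and $d<b$. A set of segments is nonoverlapping when every two distinct segments in it are either disjoint or one encloses the other. It exhausts $\mathbb{Z}\setminus\{0\}$ when every element of $\mathbb{Z}\setminus\{0\}$ is an end point of some segment in it. A segment $[a,b]$ is transversal when $a<0<b$, a cup when $0<a<b$, a cap when $a<b<0$. A frieze is a set of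 nonoverlapping segments exhausting $\mathbb{Z}\setminus\{0\}$ whose cups are all of the form $[2k+2,2k+3]$ and whose caps are all of the form $[-(2k+2),-(2k+1)]$, with $k\in\mathbb{N}$. The unit frieze is $\{[-k,k]\mid k\in\mathbb{N}^+\}$. Composition $D_2\circ D_1$ is obtained by putting the diagram of $D_2$ below the diagram of $D_1$: take three disjoint copies of the positive integers (top, middle, bottom points); regard each segment of $D_1$ as an edge, a positive end point $k$ being the top point $k$ and a negative end point $-k$ being the middle point $k$; regard each segment of $D_2$ as an edge, a positive end point $k$ being the middle point $k$ and a negative end point $-k$ being the bottom point $k$. The segments of $D_2\circ D_1$ join those pairs of distinct points among top points $k$ (read as $k$) and bottom points $k$ (read as $-k$) that are connected by a path in this graph. Friezes form a monoid with this composition and the unit frieze. A frieze is of type $(n,m)$, for $n,m\in\mathbb{N}$, when for every $k\in\mathbb{N}^+$ it contains the transversal segment $[-(m+k),n+k]$. The category $\mathcal{D}_{\mathcal{A}}$ has as objects all odd natural numbers, and as arrows from $n$ to $m$ all friezes of type $(n,m)$ indexed by $(n,m)$; $\mathcal{D}_{\mathcal{B}}$ is defined in the same way with all even natural numbers (including $0$) as objects. Composition and identities are given by composition of friezes and the unit frieze. The functors. On objects $E_{\mathcal{A}}(F(GF)^n\emptyset)=2n+1$ and $E_{\mathcal{B}}((GF)^n\emptyset)=2n$. On terms: $E_{\mathcal{A}}(\mathbf{1}_a)$ and $E_{\mathcal{B}}(\mathbf{1}_b)$ are the unit frieze indexed by $(E_{\mathcal{A}}(a),E_{\mathcal{A}}(a))$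 and $(E_{\mathcal{B}}(b),E_{\mathcal{B}}(b))$; $E_{\mathcal{A}}(f_2\circ f_1)=E_{\mathcal{A}}(f_2)\circ E_{\mathcal{A}}(f_1)$ and $E_{\mathcal{B}}(g_2\circ g_1)=E_{\mathcal{B}}(g_2)\circ E_{\mathcal{B}}(g_1)$; $E_{\mathcal{A}}(Fg)$ is $E_{\mathcal{B}}(g)$ with its index $(n,m)$ replaced by $(n+1,m+1)$, and $E_{\mathcal{B}}(Gf)$ is $E_{\mathcal{A}}(f)$ with its index $(n,m)$ replaced by $(n+1,m+1)$; if $E_{\mathcal{A}}(f)$ is indexed by $(n,m)$, then $E_{\mathcal{A}}(\varphi^{a}f)$ is the frieze indexed by $(n+2,m)$ obtained from $E_{\mathcal{A}}(f)$ by replacing all the transversal segments $[-(m+k),n+k]$, $k\in\mathbb{N}^+$, by the cup $[n+1,n+2]$ and the transversal segments $[-(m+k),n+k+2]$, $k\in\mathbb{N}^+$; if $E_{\mathcal{B}}(g)$ is indexed by $(n,m)$, then $E_{\mathcal{B}}(\gamma^{c}g)$ is the frieze indexed by $(n,m+2)$ obtained from $E_{\mathcal{B}}(g)$ by replacing all the transversal segments $[-(m+k),n+k]$, $k\in\mathbb{N}^+$, by the cap $[-(m+2),-(m+1)]$ and the transversal segments $[-(m+k+2),n+k]$, $k\in\mathbb{N}^+$. Equal terms have equal images, so $E_{\mathcal{A}}$ and $E_{\mathcal{B}}$ are defined on arrows. *)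

(* Defs.v *)
From HB Require Import structures.
From Stdlib Require Import Relations.
From mathcomp Require Import all_boot all_order all_algebra.
From mathcomp Require Import boolp classical_sets.

Set Implicit Arguments.
Unset Strict Implicit.
Unset Printing Implicit Defensive.

Import Order.TTheory GRing.Theory Num.Theory.

Local Open Scope classical_set_scope.
Local Open Scope quotient_scope.
Local Open Scope ring_scope.

(** * Categories, functors, isomorphisms of categories *)

Record category := Category {
  Ob :> Type;
  Hom : Ob -> Ob -> Type;
  idm : forall a, Hom a a;
  comp : forall a b c, Hom b c -> Hom a b -> Hom a c;
  comp_idl : forall a b (f : Hom a b), comp (idm b) f = f;
  comp_idr : forall a b (f : Hom a b), comp f (idm a) = f;
  comp_assoc : forall a b c d (f : Hom a b) (g : Hom b c) (h : Hom c d),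
    comp h (comp g f) = comp (comp h g) f }.

Record functor (C D : category) := Functor {
  fob :> C -> D;
  fhom : forall a b, Hom a b -> Hom (fob a) (fob b);
  fhom_id : forall a, fhom (idm a) = idm (fob a);
  fhom_comp : forall a b c (g : Hom b c) (f : Hom a b),
    fhom (comp g f) = comp (fhom g) (fhom f) }.

(** Arrows together with their source and target: equality of such triples
    compares arrows whose sources and targets are only propositionally equal. *)
Definition arrow (C : category) := {a : C & {b : C & Hom a b}}.

Definition fmap (C D : category) (F : functor C D) (f : arrow C) : arrow D :=
  let: existT a (existT b g) := f in existT _ (F a) (existT _ (F b) (fhom F g)).

Definition is_isomorphism (C D : category) (F : functor C D) : Prop :=
  exists G : functor D C,
    [/\ forall a : C, G (F a) = a,
        forall b : D, F (G b) = b,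
        forall f : arrow C, fmap G (fmap F f) = f
      & forall g : arrow D, fmap F (fmap G g) = g].

(** * Friezes *)

(** The pair [(a, b)] stands for the segment [[a,b]] of nonzero integers. *)
Definition is_segment (s : int * int) : Prop :=
  [/\ s.1 != 0, s.2 != 0 & s.1 < s.2].

Definition points (s : int * int) : set int :=
  [set z | z != 0 /\ s.1 <= z <= s.2].

Definition encloses (s t : int * int) : Prop := s.1 < t.1 /\ t.2 < s.2.

Definition nonoverlapping (D : set (int * int)) : Prop :=
  forall s t, D s -> D t -> s <> t ->
    [\/ points s `&` points t = set0, encloses s t | encloses t s].

Definition exhausting (D : set (int * int)) : Prop :=
  forall z : int, z != 0 -> exists s, D s /\ (z = s.1 \/ z = s.2).

Definition is_cup (s : int * int) : Prop := is_segment s /\ 0 < s.1.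
Definition is_cap (s : int * int) : Prop := is_segment s /\ s.2 < 0.

Record frieze (D : set (int * int)) : Prop := Frieze {
  frieze_segment : forall s, D s -> is_segment s;
  frieze_nonoverlapping : nonoverlapping D;
  frieze_exhausting : exhausting D;
  frieze_cup : forall s, D s -> is_cup s ->
    exists k : nat, s = ((2 * k + 2)%:Z, (2 * k + 3)%:Z);
  frieze_cap : forall s, D s -> is_cap s ->
    exists k : nat, s = (- (2 * k + 2)%:Z, - (2 * k + 1)%:Z) }.

(** The transversal segments [[-(m+k), n+k]] with [k] positive. *)
Definition tail (n m : nat) : set (int * int) :=
  [set s | exists2 k : nat, (0 < k)%N & s = (- (m + k)%:Z, (n + k)%:Z)].

Definition of_type (n m : nat) (D : set (int * int)) : Prop := tail n m `<=` D.

Definition unit_frieze : set (int * int) :=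
  [set s | exists2 k : nat, (0 < k)%N & s = (- k%:Z, k%:Z)].

(** Composition: [D1] is drawn between the top and the middle points, [D2]
    between the middle and the bottom points. *)
Inductive vertex := Top of nat | Middle of nat | Bottom of nat.

Definition upper (z : int) : vertex :=
  if 0 < z then Top `|z|%N else Middle `|z|%N.
Definition lower (z : int) : vertex :=
  if 0 < z then Middle `|z|%N else Bottom `|z|%N.
Definition outer (z : int) : vertex :=
  if 0 < z then Top `|z|%N else Bottom `|z|%N.

Inductive edge (D2 D1 : set (int * int)) : vertex -> vertex -> Prop :=
| edge_upper s : D1 s -> edge D2 D1 (upper s.1) (upper s.2)
| edge_lower s : D2 s -> edge D2 D1 (lower s.1) (lower s.2).

Definition frieze_comp (D2 D1 : set (int * int)) : set (int * int) :=
  [set s | is_segment s /\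
    clos_refl_sym_trans vertex (edge D2 D1) (outer s.1) (outer s.2)].

(** * The categories of friezes of finite type *)

Definition frieze_arrow (n m : nat) (D : set (int * int)) : Prop :=
  frieze D /\ of_type n m D.

(** What has to hold for the friezes of type [(n, m)], with [n] and [m]
    in [P], to be the arrows of a category. *)
Record frieze_category_laws (P : pred nat) : Prop := FriezeCategoryLaws {
  unit_arrow : forall n, P n -> frieze_arrow n n unit_frieze;
  comp_arrow : forall n m p D1 D2, P n -> P m -> P p ->
    frieze_arrow n m D1 -> frieze_arrow m p D2 ->
    frieze_arrow n p (frieze_comp D2 D1);
  frieze_idl : forall n m D, P n -> P m ->
    frieze_arrow n m D -> frieze_comp unit_frieze D = D;
  frieze_idr : forall n m D, P n -> P m ->
    frieze_arrow n m D -> frieze_comp D unit_frieze = D;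
  frieze_assoc : forall n m p q D1 D2 D3, P n -> P m -> P p -> P q ->
    frieze_arrow n m D1 -> frieze_arrow m p D2 -> frieze_arrow p q D3 ->
    frieze_comp D3 (frieze_comp D2 D1) = frieze_comp (frieze_comp D3 D2) D1 }.

Section FriezeCategory.
Variables (P : pred nat) (laws : frieze_category_laws P).

Let ob := {n : nat | P n}.
Let hom (n m : ob) := {D : set (int * int) | frieze_arrow (val n) (val m) D}.

Let id_hom (n : ob) : hom n n := exist _ unit_frieze (unit_arrow laws (valP n)).

Let comp_hom (n m p : ob) (D2 : hom m p) (D1 : hom n m) : hom n p :=
  exist _ (frieze_comp (sval D2) (sval D1))
    (comp_arrow laws (valP n) (valP m) (valP p) (svalP D1) (svalP D2)).

Fact comp_hom_idl n m (D : hom n m) : comp_hom (id_hom m) D = D.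
Proof.
case: D => D hD; apply: eq_exist.
exact: (frieze_idl laws (valP n) (valP m) hD).
Qed.

Fact comp_hom_idr n m (D : hom n m) : comp_hom D (id_hom n) = D.
Proof.
case: D => D hD; apply: eq_exist.
exact: (frieze_idr laws (valP n) (valP m) hD).
Qed.

Fact comp_hom_assoc n m p q (D1 : hom n m) (D2 : hom m p) (D3 : hom p q) :
  comp_hom D3 (comp_hom D2 D1) = comp_hom (comp_hom D3 D2) D1.
Proof.
apply: eq_exist.
exact: (frieze_assoc laws (valP n) (valP m) (valP p) (valP q)
          (svalP D1) (svalP D2) (svalP D3)).
Qed.

Definition frieze_category : category :=
  Category comp_hom_idl comp_hom_idr comp_hom_assoc.
End FriezeCategory.

Definition D_A (laws : frieze_category_laws odd) : category :=
  frieze_category laws.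
Definition D_B (laws : frieze_category_laws (predC odd)) : category :=
  frieze_category laws.

(** * The free adjunction *)

(** Words [F (GF)^n ∅] and [(GF)^n ∅]. *)
Inductive obA := F of obB with obB := Empty | G of obA.

Inductive termA : obA -> obA -> Type :=
| idA a : termA a a
| compA a1 a2 a3 : termA a2 a3 -> termA a1 a2 -> termA a1 a3
| Fmap b1 b2 : termB b1 b2 -> termA (F b1) (F b2)
| phi a1 a2 : termA a1 a2 -> termA (F (G a1)) a2
with termB : obB -> obB -> Type :=
| idB b : termB b b
| compB b1 b2 b3 : termB b2 b3 -> termB b1 b2 -> termB b1 b3
| Gmap a1 a2 : termA a1 a2 -> termB (G a1) (G a2)
| gamma b1 b2 : termB b1 b2 -> termB b1 (G (F b2)).

Inductive eqA : forall a1 a2, termA a1 a2 -> termA a1 a2 -> Prop :=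
| eqA_refl a1 a2 (f : termA a1 a2) : eqA f f
| eqA_sym a1 a2 (f f' : termA a1 a2) : eqA f f' -> eqA f' f
| eqA_trans a1 a2 (f f' f'' : termA a1 a2) :
    eqA f f' -> eqA f' f'' -> eqA f f''
| eqA_comp a1 a2 a3 (f2 f2' : termA a2 a3) (f1 f1' : termA a1 a2) :
    eqA f2 f2' -> eqA f1 f1' -> eqA (compA f2 f1) (compA f2' f1')
| eqA_Fmap b1 b2 (g g' : termB b1 b2) : eqB g g' -> eqA (Fmap g) (Fmap g')
| eqA_phi a1 a2 (f f' : termA a1 a2) : eqA f f' -> eqA (phi f) (phi f')
| eqA_idl a1 a2 (f : termA a1 a2) : eqA (compA (idA a2) f) f
| eqA_idr a1 a2 (f : termA a1 a2) : eqA (compA f (idA a1)) f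
| eqA_assoc a1 a2 a3 a4
    (f1 : termA a1 a2) (f2 : termA a2 a3) (f3 : termA a3 a4) :
    eqA (compA f3 (compA f2 f1)) (compA (compA f3 f2) f1)
| eqA_F_id b : eqA (Fmap (idB b)) (idA (F b))
| eqA_F_comp b1 b2 b3 (g2 : termB b2 b3) (g1 : termB b1 b2) :
    eqA (compA (Fmap g2) (Fmap g1)) (Fmap (compB g2 g1))
| eqA_comp_phi a1 a2 a3 (f2 : termA a2 a3) (f1 : termA a1 a2) :
    eqA (compA f2 (phi f1)) (phi (compA f2 f1))
| eqA_phi_FG a1 a2 a3 (f2 : termA a2 a3) (f1 : termA a1 a2) :
    eqA (compA (phi f2) (Fmap (Gmap f1))) (phi (compA f2 f1))
| eqA_phi_gamma b1 b2 a (f : termA (F b2) a) (g : termB b1 b2) :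
    eqA (compA (phi f) (Fmap (gamma g))) (compA f (Fmap g))
with eqB : forall b1 b2, termB b1 b2 -> termB b1 b2 -> Prop :=
| eqB_refl b1 b2 (g : termB b1 b2) : eqB g g
| eqB_sym b1 b2 (g g' : termB b1 b2) : eqB g g' -> eqB g' g
| eqB_trans b1 b2 (g g' g'' : termB b1 b2) :
    eqB g g' -> eqB g' g'' -> eqB g g''
| eqB_comp b1 b2 b3 (g2 g2' : termB b2 b3) (g1 g1' : termB b1 b2) :
    eqB g2 g2' -> eqB g1 g1' -> eqB (compB g2 g1) (compB g2' g1')
| eqB_Gmap a1 a2 (f f' : termA a1 a2) : eqA f f' -> eqB (Gmap f) (Gmap f')
| eqB_gamma b1 b2 (g g' : termB b1 b2) : eqB g g' -> eqB (gamma g) (gamma g')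
| eqB_idl b1 b2 (g : termB b1 b2) : eqB (compB (idB b2) g) g
| eqB_idr b1 b2 (g : termB b1 b2) : eqB (compB g (idB b1)) g
| eqB_assoc b1 b2 b3 b4
    (g1 : termB b1 b2) (g2 : termB b2 b3) (g3 : termB b3 b4) :
    eqB (compB g3 (compB g2 g1)) (compB (compB g3 g2) g1)
| eqB_G_id a : eqB (Gmap (idA a)) (idB (G a))
| eqB_G_comp a1 a2 a3 (f2 : termA a2 a3) (f1 : termA a1 a2) :
    eqB (compB (Gmap f2) (Gmap f1)) (Gmap (compA f2 f1))
| eqB_gamma_comp b1 b2 b3 (g2 : termB b2 b3) (g1 : termB b1 b2) :
    eqB (compB (gamma g2) g1) (gamma (compB g2 g1))
| eqB_GF_gamma b1 b2 b3 (g2 : termB b2 b3) (g1 : termB b1 b2) :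
    eqB (compB (Gmap (Fmap g2)) (gamma g1)) (gamma (compB g2 g1))
| eqB_phi_gamma b a1 a2 (f : termA a1 a2) (g : termB b (G a1)) :
    eqB (compB (Gmap (phi f)) (gamma g)) (compB (Gmap f) g).

(** Arrows are equivalence classes of terms. *)
Section TermCategory.
Variables (ob : Type) (term : ob -> ob -> Type).
Variables (idt : forall a, term a a).
Variables (compt : forall a b c, term b c -> term a b -> term a c).
Variables (eqt : forall a b, term a b -> term a b -> Prop).
Hypothesis eqt_refl : forall a b (f : term a b), eqt f f.
Hypothesis eqt_sym : forall a b (f g : term a b), eqt f g -> eqt g f.
Hypothesis eqt_trans : forall a b (f g h : term a b),
  eqt f g -> eqt g h -> eqt f h.
Hypothesis eqt_comp : forall a b c (g g' : term b c) (f f' : term a b),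
  eqt g g' -> eqt f f' -> eqt (compt g f) (compt g' f').
Hypothesis eqt_idl : forall a b (f : term a b), eqt (compt (idt b) f) f.
Hypothesis eqt_idr : forall a b (f : term a b), eqt (compt f (idt a)) f.
Hypothesis eqt_assoc :
  forall a b c d (f : term a b) (g : term b c) (h : term c d),
  eqt (compt h (compt g f)) (compt (compt h g) f).

Let eqtb a b : rel {classic term a b} := fun f g => `[< eqt f g >].

Fact eqtb_equiv a b : equiv_class_of (@eqtb a b).
Proof.
split.
- by move=> f; apply/asboolP.
- by move=> f g; apply/asboolP/asboolP => /eqt_sym.
- by move=> f g h /asboolP gf /asboolP fh; apply/asboolP/(eqt_trans gf fh).
Qed.

Definition term_equiv a b : equiv_rel {classic term a b} :=
  EquivRelPack (eqtb_equiv a b).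

Definition term_class a b := {eq_quot (term_equiv a b)}.

Definition class_of a b (f : term a b) : term_class a b :=
  \pi_(term_class a b) f.

Fact class_of_eq a b (f g : term a b) : class_of f = class_of g <-> eqt f g.
Proof. by split=> [/eqmodP/asboolP|fg] //; apply/eqmodP/asboolP. Qed.

Fact class_ofK a b (f : term_class a b) : class_of (repr f) = f.
Proof. exact: reprK. Qed.

Fact repr_class_of a b (f : term a b) : eqt (repr (class_of f)) f.
Proof. by apply/class_of_eq; rewrite class_ofK. Qed.

Let idc a : term_class a a := class_of (idt a).
Let compc a b c (g : term_class b c) (f : term_class a b) : term_class a c :=
  class_of (compt (repr g) (repr f)).

Fact compc_idl a b (f : term_class a b) : compc (idc b) f = f.
Proof.
rewrite -[RHS]class_ofK; apply/class_of_eq.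
exact: eqt_trans (eqt_comp (repr_class_of _) (eqt_refl _)) (eqt_idl _).
Qed.

Fact compc_idr a b (f : term_class a b) : compc f (idc a) = f.
Proof.
rewrite -[RHS]class_ofK; apply/class_of_eq.
exact: eqt_trans (eqt_comp (eqt_refl _) (repr_class_of _)) (eqt_idr _).
Qed.

Fact compc_assoc a b c d
    (f : term_class a b) (g : term_class b c) (h : term_class c d) :
  compc h (compc g f) = compc (compc h g) f.
Proof.
apply/class_of_eq.
apply: eqt_trans (eqt_comp (eqt_refl _) (repr_class_of _)) _.
apply: eqt_trans (eqt_assoc _ _ _) _.
exact: eqt_comp (eqt_sym (repr_class_of _)) (eqt_refl _).
Qed.

Definition term_category : category :=
  Category compc_idl compc_idr compc_assoc.
End TermCategory.

Definition A : category :=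
  term_category eqA_refl eqA_sym eqA_trans eqA_comp eqA_idl eqA_idr eqA_assoc.
Definition B : category :=
  term_category eqB_refl eqB_sym eqB_trans eqB_comp eqB_idl eqB_idr eqB_assoc.

(** * The functors [E_A] and [E_B] *)

Fixpoint lenA (a : obA) : nat := let: F b := a in (lenB b).+1
with lenB (b : obB) : nat := if b is G a then (lenA a).+1 else 0%N.

Fact lenB_word n : lenB (iter n (fun b => G (F b)) Empty) = (2 * n)%N.
Proof. by elim: n => //= n ->; rewrite mulnS. Qed.

Fact lenA_word n : lenA (F (iter n (fun b => G (F b)) Empty)) = (2 * n + 1)%N.
Proof. by rewrite /= lenB_word addn1. Qed.

Fixpoint odd_lenA (a : obA) : odd (lenA a) :=
  match a with F b => even_lenB b end
with even_lenB (b : obB) : predC odd (lenB b) :=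
  match b with
  | Empty => isT
  | G a => introT negPn (odd_lenA a)
  end.

(** [D] is meant to be of type [(n, m)]. *)
Definition add_cup (n m : nat) (D : set (int * int)) : set (int * int) :=
  (D `\` tail n m) `|` [set ((n + 1)%:Z, (n + 2)%:Z)] `|` tail (n + 2) m.
Definition add_cap (n m : nat) (D : set (int * int)) : set (int * int) :=
  (D `\` tail n m) `|` [set (- (m + 2)%:Z, - (m + 1)%:Z)] `|` tail n (m + 2).

(** The indices of the friezes are determined by the types of the terms. *)
Fixpoint friezeA a1 a2 (f : termA a1 a2) : set (int * int) :=
  match f with
  | idA _ => unit_frieze
  | compA _ _ _ f2 f1 => frieze_comp (friezeA f2) (friezeA f1)
  | Fmap _ _ g => friezeB g
  | phi a1 a2 f => add_cup (lenA a1) (lenA a2) (friezeA f)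
  end
with friezeB b1 b2 (g : termB b1 b2) : set (int * int) :=
  match g with
  | idB _ => unit_frieze
  | compB _ _ _ g2 g1 => frieze_comp (friezeB g2) (friezeB g1)
  | Gmap _ _ f => friezeA f
  | gamma b1 b2 g => add_cap (lenB b1) (lenB b2) (friezeB g)
  end.

(** Terms denote friezes of the right type, and equal terms the same frieze. *)
Record friezes_well_defined : Prop := FriezesWellDefined {
  friezeA_arrow : forall a1 a2 (f : termA a1 a2),
    frieze_arrow (lenA a1) (lenA a2) (friezeA f);
  friezeB_arrow : forall b1 b2 (g : termB b1 b2),
    frieze_arrow (lenB b1) (lenB b2) (friezeB g);
  friezeA_eq : forall a1 a2 (f f' : termA a1 a2),
    eqA f f' -> friezeA f = friezeA f';
  friezeB_eq : forall b1 b2 (g g' : termB b1 b2),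
    eqB g g' -> friezeB g = friezeB g' }.

Section FunctorA.
Variables (laws : frieze_category_laws odd) (wd : friezes_well_defined).

Let obmap (a : A) : D_A laws := exist _ (lenA a) (odd_lenA a).

Let hommap (a1 a2 : A) (f : Hom a1 a2) : Hom (obmap a1) (obmap a2) :=
  exist _ (friezeA (repr f)) (friezeA_arrow wd (repr f)).

Fact hommapA_id (a : A) : hommap (idm a) = idm (obmap a).
Proof. by apply: eq_exist; apply: (friezeA_eq wd (repr_class_of _ _ _ _)). Qed.

Fact hommapA_comp (a1 a2 a3 : A) (f2 : Hom a2 a3) (f1 : Hom a1 a2) :
  hommap (comp f2 f1) = comp (hommap f2) (hommap f1).
Proof. by apply: eq_exist; apply: (friezeA_eq wd (repr_class_of _ _ _ _)). Qed.

Definition E_A : functor A (D_A laws) := Functor hommapA_id hommapA_comp.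
End FunctorA.

Section FunctorB.
Variables (laws : frieze_category_laws (predC odd)).
Variables (wd : friezes_well_defined).

Let obmap (b : B) : D_B laws := exist _ (lenB b) (even_lenB b).

Let hommap (b1 b2 : B) (g : Hom b1 b2) : Hom (obmap b1) (obmap b2) :=
  exist _ (friezeB (repr g)) (friezeB_arrow wd (repr g)).

Fact hommapB_id (b : B) : hommap (idm b) = idm (obmap b).
Proof. by apply: eq_exist; apply: (friezeB_eq wd (repr_class_of _ _ _ _)). Qed.

Fact hommapB_comp (b1 b2 b3 : B) (g2 : Hom b2 b3) (g1 : Hom b1 b2) :
  hommap (comp g2 g1) = comp (hommap g2) (hommap g1).
Proof. by apply: eq_exist; apply: (friezeB_eq wd (repr_class_of _ _ _ _)). Qed.

Definition E_B : functor B (D_B laws) := Functor hommapB_id hommapB_comp.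
End FunctorB.

(* Main.v *)
Require Import Defs.
From Stdlib Require Import Relations Program.Equality Eqdep.
From mathcomp Require Import all_boot all_order all_algebra.
From mathcomp Require Import boolp classical_sets zify.

Import Order.TTheory.
Import Defs.

Set Implicit Arguments.
Unset Strict Implicit.
Unset Printing Implicit Defensive.

(** Friezes of finite type are pictures of monotone maps, and so are the terms.

    Shade the strip of a frieze alternately: the top points [2i+1] and [2i+2]
    bound the shaded top interval [i], the top points [2i] and [2i+1] bound
    the white top gap [i] (the gap [0] extends to the left edge), and likewise
    at the bottom.  The condition on the form of caps says that every shaded
    region meets the bottom in exactly one interval, and the condition on cups
    that every white region meets the top in exactly one gap.  Sending a shaded top interval to the bottom interval
    of its region gives a monotone map [f], and sending a white bottom gap to
    the top gap of its region gives its left adjoint.  Conversely [f]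
    determines the frieze: two points are joined exactly when they have the
    same shaded and the same white region on their sides, which is the
    definition of [frieze_of f].  Composition of friezes is composition of
    maps ([frieze_of_comp]), because regions are propagated by composing maps
    and middle points with equal regions are joined step by step; and every
    frieze of finite type is recovered from the position of its transversal
    segments ([frieze_arrowP]).  The laws of the categories of friezes are
    then those of composition of maps.

    A term denotes a map in the same way ([evA], [evB]): [F] and [G] change
    nothing, [phi] identifies two adjacent arguments, [gamma] omits one value.
    The equations of the free adjunction become identities between such maps,
    so the friezes of terms are well defined.  By cut elimination every term
    equals one without composition ([normalize]).  Such a normal term can be
    read off its map ([norm_inj]), whence faithfulness; and every map of the
    right type is the value of a term ([ev_full]), whence fullness.  Objects
    are determined by their lengths, and a fully faithful functor that is
    bijective on objects is an isomorphism. *)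

(** * Friezes and their transversal segments *)

Section FriezeTheory.
Variables (D : set (int * int)) (fD : frieze D).

Lemma frieze_end_unique s t : D s -> D t ->
  s.1 = t.1 \/ s.1 = t.2 \/ s.2 = t.1 \/ s.2 = t.2 -> s = t.
Proof.
move=> Ds Dt end_st; apply: contrapT => ne_st.
have [s1 s2 lt_s] := frieze_segment fD Ds.
have [t1 t2 lt_t] := frieze_segment fD Dt.
have [/seteqP [dis _]|[]|[]] := frieze_nonoverlapping fD Ds Dt ne_st; try lia.
have {}dis z : z = s.1 \/ z = s.2 -> z = t.1 \/ z = t.2 -> False.
  by move=> zs zt; apply: (dis z); split; split; lia.
by case: end_st => [|[|[]]] e; [apply: (dis s.1)|apply: (dis s.1)|
  apply: (dis s.2)|apply: (dis s.2)]; rewrite e; auto.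
Qed.

(** An end point determines its segment, so a frieze has no room for a segment
    that an exhausting subset lacks. *)
Lemma exhausting_sub_frieze X : exhausting X -> (X `<=` D)%classic -> X = D.
Proof.
move=> exX XD; apply/seteqP; split=> // s Ds.
have [s1 _ _] := frieze_segment fD Ds.
have [t [Xt st]] := exX _ s1.
suff <- : t = s by [].
by apply: frieze_end_unique => //; [exact: XD | case: st => ->; auto].
Qed.

(** The bottom point [q] and the top point [p] are joined. *)
Definition through (q p : nat) := [/\ 0 < q, 0 < p & D (- q%:Z, p%:Z)%R].

Lemma through_top q q' p : through q p -> through q' p -> q = q'.
Proof.
move=> [_ _ Dq] [_ _ Dq'].
by have [] := frieze_end_unique Dq Dq' (or_intror (or_intror (or_intror erefl))); lia.
Qed.

Lemma through_bottom q p p' : through q p -> through q p' -> p = p'.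
Proof.
move=> [_ _ Dq] [_ _ Dq'].
by have [] := frieze_end_unique Dq Dq' (or_introl erefl); lia.
Qed.

Lemma through_lt q p q' p' :
  through q p -> through q' p' -> (q < q') = (p < p').
Proof.
move=> T T'.
have ne : p = p' <-> q = q'.
  split=> e; first by rewrite -e in T'; exact: through_top T T'.
  by rewrite -e in T'; exact: through_bottom T T'.
case: T T' => q0 p0 Dq [q'0 p'0 Dq'].
have [e|{}ne] := EM (p = p'); first by rewrite e; have := ne.1 e; lia.
have neS : (- q%:Z, p%:Z)%R <> (- q'%:Z, p'%:Z)%R by case; lia.
have [/seteqP [dis _]|[]|[]] := frieze_nonoverlapping fD Dq Dq' neS => /=; try lia.
by exfalso; apply: (dis 1%R); split; split=> /=; lia.
Qed.

Lemma top_cases p : 0 < p ->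
  (exists q, through q p) \/
  (exists2 k : nat, p = 2 * k + 2 \/ p = 2 * k + 3 &
     D ((2 * k + 2)%:Z, (2 * k + 3)%:Z)%R).
Proof.
move=> p0; have [|[a b] [Ds /= ps]] := frieze_exhausting fD (z := p%:Z%R); first lia.
have [/= a0 b0 ab] := frieze_segment fD Ds.
have [lt0a|le_a0] := EM (0 < a)%R.
  have cup : is_cup (a, b) by [].
  by have [k e] := frieze_cup fD Ds cup; right; exists k; [case: e; lia|rewrite -e].
left; exists `|a|%N; split; try lia.
by have -> : (- `|a|%N%:Z = a)%R; [lia | have <- : b = p by lia].
Qed.

Lemma bottom_cases q : 0 < q ->
  (exists p, through q p) \/
  (exists2 k : nat, q = 2 * k + 2 \/ q = 2 * k + 1 &
     D (- (2 * k + 2)%:Z, - (2 * k + 1)%:Z)%R).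
Proof.
move=> q0; have [|[a b] [Ds /= ps]] := frieze_exhausting fD (z := (- q%:Z)%R); first lia.
have [/= a0 b0 ab] := frieze_segment fD Ds.
have [ltb0|le0b] := EM (b < 0)%R.
  have cap : is_cap (a, b) by [].
  by have [k e] := frieze_cap fD Ds cap; right; exists k; [case: e; lia|rewrite -e].
left; exists `|b|%N; split; try lia.
by have -> : (`|b|%N%:Z = b)%R; [lia | have <- : a = (- q%:Z)%R by lia].
Qed.

Lemma through_cup q p k :
  through q p -> D ((2 * k + 2)%:Z, (2 * k + 3)%:Z)%R ->
  p <> 2 * k + 2 /\ p <> 2 * k + 3.
Proof.
move=> [q0 p0 T] cup; split=> e.
  by have := frieze_end_unique T cup; rewrite /= e => /(_ ltac:(auto)) []; lia.
by have := frieze_end_unique T cup; rewrite /= e => /(_ ltac:(auto)) []; lia.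
Qed.

Lemma through_cap q p k :
  through q p -> D (- (2 * k + 2)%:Z, - (2 * k + 1)%:Z)%R ->
  q <> 2 * k + 2 /\ q <> 2 * k + 1.
Proof.
move=> [q0 p0 T] cap; split=> e.
  by have := frieze_end_unique T cap; rewrite /= e => /(_ ltac:(auto)) []; lia.
by have := frieze_end_unique T cap; rewrite /= e => /(_ ltac:(auto)) []; lia.
Qed.

(** Between two successive transversal segments there are only cups and caps, and
    their prescribed positions fix the parity of the ends that they can skip.
    So a transversal segment with ends of different parity has a predecessor of
    the same kind, which is absurd by descent. *)
Lemma through_odd q p : through q p -> odd q = odd p.
Proof.
elim/ltn_ind: p q => p IH q T.
have [q0 p0 _] := T.
have IH' q' p' : through q' p' -> p' < p -> odd q' = odd p' by eauto.
case op: (odd p); case oq: (odd q) => //.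
- (* the neighbours [p - 1] and [q - 1] are joined *)
  have [[p' T']|[k qk cap]] := @bottom_cases q.-1 ltac:(lia); last first.
    by have := through_cap T cap; lia.
  have := through_lt T' T; have := T'; case=> _ p'0 _ lt'.
  have [[q' T2]|[k pk cup]] := @top_cases p.-1 ltac:(lia); last first.
    by have := through_cup T cup; lia.
  have lt2 := through_lt T2 T; have lt3 := through_lt T' T2.
  have lt4 := through_lt T2 T'.
  have e : p' = p.-1 by lia.
  by have := IH' _ _ T'; lia.
- (* the last throughs before [p] and [q] are joined *)
  have [[q1 T1]|[k pk cup]] := @top_cases 1 isT; last by lia.
  have p1 : p != 1 by lia.
  have lt1 := through_lt T1 T.
  pose P r := `[< exists q, through q r >] && (r < p).
  have exP : exists r, P r by exists 1; apply/andP; split; [apply/asboolP; exists q1|lia].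
  have ubP r : P r -> r <= p by case/andP=> _ /ltnW.
  case: (ex_maxnP exP ubP) => p' /andP [/asboolP [q' T'] p'p] maxp'.
  have lt' := through_lt T' T.
  have T'_ := T'; case: T'_ => q'0 p'0 _.
  have op' : odd p'.
    have [[q2 T2]|[k pk cup]] := @top_cases p'.+1 isT.
      suff : p <= p'.+1 by lia.
      rewrite leqNgt; apply/negP => lt_p.
      suff : p'.+1 <= p' by lia.
      by apply: maxp'; apply/andP; split; [apply/asboolP; exists q2|].
    by have := through_cup T' cup; lia.
  have eq' : ~~ odd q'.
    have [[p2 T2]|[k pk cap]] := @bottom_cases q'.+1 isT; last first.
      by have := through_cap T' cap; lia.
    have lt2 := through_lt T2 T; have lt3 := through_lt T' T2.
    suff : q <= q'.+1 by lia.
    rewrite leqNgt; apply/negP => lt_q.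
    suff : p2 <= p' by lia.
    by apply: maxp'; apply/andP; split; [apply/asboolP; exists q'.+1|lia].
  by have := IH' _ _ T'; lia.
Qed.

End FriezeTheory.

(** * The frieze of an adjunction between the natural numbers *)

(** A monotone and unbounded map, together with its left adjoint.  The map acts
    on shaded regions and the adjoint on white ones, and the label of a point
    needs both. *)
Record galois := Galois {
  ra :> nat -> nat;
  la : nat -> nat;
  galP : forall i j, (la j <= i) = (j <= ra i) }.

Lemma ra_mono (f : galois) i i' : i <= i' -> f i <= f i'.
Proof. by move=> le_i; rewrite -galP (leq_trans _ le_i) // galP. Qed.

Lemma la_mono (f : galois) j j' : j <= j' -> la f j <= la f j'.
Proof. by move=> le_j; rewrite galP (leq_trans le_j) // -galP. Qed.

Lemma galois_ext (f g : galois) : ra f =1 ra g -> f = g.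
Proof.
case: f g => [f fl fP] [g gl gP] /= /funext e; subst g.
have e : fl = gl.
  by apply/funext=> j; apply/eqP; rewrite eqn_leq fP -gP leqnn gP -fP leqnn.
by subst gl; congr Galois; apply: Prop_irrelevance.
Qed.

Definition id_gal := @Galois id id (fun _ _ => erefl).

Fact comp_galP (g f : galois) i j : (la f (la g j) <= i) = (j <= g (f i)).
Proof. by rewrite !galP. Qed.

Definition comp_gal (g f : galois) :=
  @Galois (g \o f) (la f \o la g) (comp_galP g f).

Section Labels.
Variable f : galois.

(** [shaded z] and [white z] are the two regions that meet at the point [z], a
    shaded region being named by its bottom interval and a white one by its top
    gap. *)
Definition shaded (z : int) : nat :=
  if (0 < z)%R then f `|z|.-1./2%N else `|z|.-1./2%N.
Definition white (z : int) : nat :=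
  if (0 < z)%R then `|z|./2%N else la f `|z|./2%N.

Definition frieze_of : set (int * int) :=
  [set s | [/\ is_segment s, shaded s.1 = shaded s.2 & white s.1 = white s.2]]%classic.

Lemma shaded_mono x y : `|x| <= `|y| -> (0 < x)%R = (0 < y)%R -> shaded x <= shaded y.
Proof.
move=> xy e; rewrite /shaded e; case: ifP => _; last by lia.
by apply: ra_mono; lia.
Qed.

Lemma white_mono x y : `|x| <= `|y| -> (0 < x)%R = (0 < y)%R -> white x <= white y.
Proof.
move=> xy e; rewrite /white e; case: ifP => _; first by lia.
by apply: la_mono; lia.
Qed.

(** White regions meet the top in one gap, so only the two ends of that gap can
    be joined; this is where the form of cups comes from. *)
Lemma top_pair x y : (0 < x < y)%R -> white x = white y ->
  exists2 k : nat, x = (2 * k + 2)%:Z%R & y = (2 * k + 3)%:Z%R.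
Proof.
move=> xy; rewrite /white !ifT; try lia.
by move=> e; exists (`|x|./2.-1)%N; lia.
Qed.

Lemma bottom_pair x y : (x < y < 0)%R -> shaded x = shaded y ->
  exists2 k : nat, x = (- (2 * k + 2)%:Z)%R & y = (- (2 * k + 1)%:Z)%R.
Proof.
move=> xy; rewrite /shaded !ifF; try lia.
by move=> e; exists (`|x|.-1./2)%N; lia.
Qed.

Lemma shaded_top (n : nat) : 0 < n -> shaded n%:Z%R = f n.-1./2.
Proof. by move=> n0; rewrite /shaded ifT. Qed.
Lemma white_top (n : nat) : 0 < n -> white n%:Z%R = n./2.
Proof. by move=> n0; rewrite /white ifT. Qed.
Lemma shaded_bottom (n : nat) : shaded (- n%:Z)%R = n.-1./2.
Proof. by rewrite /shaded ifF; lia. Qed.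
Lemma white_bottom (n : nat) : white (- n%:Z)%R = la f n./2.
Proof. by rewrite /white ifF; [congr la; lia | lia]. Qed.

Definition same_label x y := shaded x = shaded y /\ white x = white y.

Lemma same_labelC x y : same_label x y -> same_label y x.
Proof. by case. Qed.

Lemma same_labelT y x z : same_label x y -> same_label y z -> same_label x z.
Proof. by rewrite /same_label => -[-> ->]. Qed.

(** If the two top intervals beside a cup lie in one shaded region, the gap
    inside the cup is cut off from the bottom. *)
Lemma cup_bottom_label k z : (z < 0)%R ->
  same_label (2 * k + 2)%:Z%R (2 * k + 3)%:Z%R -> ~ same_label (2 * k + 2)%:Z%R z.
Proof.
move=> z0; rewrite /same_label !shaded_top ?white_top; try lia.
have -> : (2 * k + 2).-1./2 = k by lia.
have -> : (2 * k + 3).-1./2 = k.+1 by lia.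
have -> : (2 * k + 2)./2 = k.+1 by lia.
rewrite /shaded /white !ifF; try lia.
move=> [s1 _] [s2 w].
have := galP f k `|z|./2; have := galP f k.+1 `|z|./2; lia.
Qed.

Lemma cap_top_label k z : (0 < z)%R ->
  same_label (- (2 * k + 2)%:Z)%R (- (2 * k + 1)%:Z)%R ->
  ~ same_label (- (2 * k + 2)%:Z)%R z.
Proof.
rewrite /same_label !shaded_bottom !white_bottom.
have -> : (2 * k + 2).-1./2 = k by lia.
have -> : (2 * k + 2)./2 = k.+1 by lia.
have -> : (2 * k + 1)./2 = k by lia.
rewrite /shaded /white => z0; rewrite !ifT // => [] [_ w1] [s w].
have := galP f `|z|.-1./2 k; have := galP f `|z|.-1./2 k.+1; lia.
Qed.

(** Among three points two are on the same side, hence form a cup or a cap, and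
    the region enclosed by it does not reach the third point. *)
Lemma no_three_labels x y z : x != 0%R -> y != 0%R -> z != 0%R ->
  (x < y < z)%R -> same_label x y -> ~ same_label y z.
Proof.
move=> x0 y0 z0 lt_xyz xy yz.
have [gt0y|lt0y] := EM (0 < y)%R.
  have [|k ey ez] := @top_pair y z _ (proj2 yz); first lia.
  have [gt0x|lt0x] := EM (0 < x)%R.
    have [|k' ex' ey'] := @top_pair x y _ (proj2 xy); lia.
  apply: (@cup_bottom_label k x); first lia.
    by rewrite -ey -ez.
  by rewrite -ey; apply: same_labelC.
have [|k ex ey] := @bottom_pair x y _ (proj1 xy); first lia.
have [gt0z|lt0z] := EM (0 < z)%R.
  apply: (@cap_top_label k z) => //; first by rewrite -ex -ey.
  by rewrite -ex; apply: same_labelT yz.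
by have [|k' ex' ey'] := @bottom_pair y z _ (proj1 yz); lia.
Qed.

Lemma label_unique x y z : x != 0%R -> y != 0%R -> z != 0%R ->
  same_label x y -> same_label x z -> [\/ x = y, x = z | y = z].
Proof.
move=> x0 y0 z0 xy xz.
have yz := same_labelT (same_labelC xy) xz.
have [xy' zy' zx'] := And3 (same_labelC xy) (same_labelC yz) (same_labelC xz).
case: (ltgtP x y) => [lt1|lt1|]; last by move=> e; apply: Or31.
all: case: (ltgtP x z) => [lt2|lt2|]; last by move=> e; apply: Or32.
all: case: (ltgtP y z) => [lt3|lt3|]; last by move=> e; apply: Or33.
all: try lia.
all: exfalso.
- by apply: (@no_three_labels x y z) => //; lia.
- by apply: (@no_three_labels x z y) => //; lia.
- by apply: (@no_three_labels z x y) => //; lia.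
- by apply: (@no_three_labels y x z) => //; lia.
- by apply: (@no_three_labels y z x) => //; lia.
- by apply: (@no_three_labels z y x) => //; lia.
Qed.

(** The candidates are the neighbour of [x] across its white gap (at the top) or
    its shaded interval (at the bottom), and the end point on the other side
    which the map or its adjoint assigns to [x]. *)
Lemma label_exists x : x != 0%R -> exists y, [/\ y != 0%R, y <> x & same_label x y].
Proof.
move=> x0; rewrite /same_label.
suff H (n : nat) : 0 < n ->
    (exists y, [/\ y != 0%R, y <> n%:Z%R & same_label n%:Z%R y]) /\
    (exists y, [/\ y != 0%R, y <> (- n%:Z)%R & same_label (- n%:Z)%R y]).
  have [Ht Hb] := H `|x|%N ltac:(lia).
  have [gt0x|lt0x] := EM (0 < x)%R.
    by have -> : x = `|x|%N%:Z%R by lia.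
  by have -> : x = (- `|x|%N%:Z)%R by lia.
rewrite /same_label => n0; rewrite shaded_top // white_top // shaded_bottom white_bottom.
move on : (odd n) => [].
- have [i en] : exists i, n = 2 * i + 1 by exists n./2; lia.
  have -> : n.-1./2 = i by lia.
  have -> : n./2 = i by lia.
  split.
    have [e|ne] := EM (la f (f i) = i).
      exists (- (2 * f i + 1)%:Z)%R; rewrite shaded_bottom white_bottom.
      have -> : (2 * f i + 1).-1./2 = f i by lia.
      have -> : (2 * f i + 1)./2 = f i by lia.
      by split=> //; lia.
    have := galP f i (f i); have := galP f i.-1 (f i); rewrite leqnn => g1 g2.
    have i0 : 0 < i by lia.
    exists (2 * i)%:Z%R; rewrite shaded_top ?white_top; try lia.
    have -> : (2 * i).-1./2 = i.-1 by lia.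
    by have := @ra_mono f i.-1 i; split=> //; lia.
  have [e|ne] := EM (la f i = la f i.+1).
    exists (- (2 * i + 2)%:Z)%R; rewrite shaded_bottom white_bottom.
    have -> : (2 * i + 2).-1./2 = i by lia.
    have -> : (2 * i + 2)./2 = i.+1 by lia.
    by split=> //; lia.
  exists (2 * la f i + 1)%:Z%R; rewrite shaded_top ?white_top; try lia.
  have -> : (2 * la f i + 1).-1./2 = la f i by lia.
  have := @la_mono f i i.+1; have := galP f (la f i) i; have := galP f (la f i) i.+1.
  by split=> //; lia.
have [i en] : exists i, n = 2 * i + 2 by exists n./2.-1; lia.
have -> : n.-1./2 = i by lia.
have -> : n./2 = i.+1 by lia.
split.
  have [e|ne] := EM (f i = f i.+1).
    exists (2 * i + 3)%:Z%R; rewrite shaded_top ?white_top; try lia.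
    have -> : (2 * i + 3).-1./2 = i.+1 by lia.
    by split=> //; lia.
  exists (- (2 * f i + 2)%:Z)%R; rewrite shaded_bottom white_bottom.
  have -> : (2 * f i + 2).-1./2 = f i by lia.
  have -> : (2 * f i + 2)./2 = (f i).+1 by lia.
  have := @ra_mono f i i.+1; have := galP f i (f i).+1; have := galP f i.+1 (f i).+1.
  by split=> //; lia.
have [e|ne] := EM (la f i = la f i.+1).
  exists (- (2 * i + 1)%:Z)%R; rewrite shaded_bottom white_bottom.
  have -> : (2 * i + 1).-1./2 = i by lia.
  have -> : (2 * i + 1)./2 = i by lia.
  by split=> //; lia.
exists (2 * la f i.+1)%:Z%R.
have := @la_mono f i i.+1.
have := galP f (la f i.+1).-1 i; have := galP f (la f i.+1).-1 i.+1 => *.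
rewrite shaded_top ?white_top; try lia.
have -> : (2 * la f i.+1).-1./2 = (la f i.+1).-1 by lia.
by split; lia.
Qed.

Lemma frieze_ofP x y : x != 0%R -> y != 0%R -> x <> y -> same_label x y ->
  frieze_of (x, y) \/ frieze_of (y, x).
Proof.
move=> x0 y0 xy [s w]; have [lt|gt] := EM (x < y)%R; [left|right].
  by split=> //; split=> //=; lia.
by split=> //; split=> //=; lia.
Qed.

Lemma frieze_of_segment s : frieze_of s ->
  [/\ s.1 != 0%R, s.2 != 0%R, (s.1 < s.2)%R & same_label s.1 s.2].
Proof. by move=> [[] *]; split. Qed.

(** Distinct segments have no end in common because labels are shared by at most
    two points.  Cups and caps join neighbours, so they cross nothing; and if two
    transversal segments crossed, monotonicity of the labels along either side
    would make all four labels equal. *)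
Lemma frieze_frieze_of : frieze frieze_of.
Proof.
split.
- by move=> s [].
- move=> s t Ds Dt ne_st.
  have [s1 s2 lt_s lab_s] := frieze_of_segment Ds.
  have [t1 t2 lt_t lab_t] := frieze_of_segment Dt.
  have uniq x y : x = s.1 \/ x = s.2 -> y = t.1 \/ y = t.2 -> ~ same_label x y.
    move=> xs yt xy; apply: ne_st.
    have st : same_label s.1 t.1.
      case: xs xy => ->; case: yt => -> xy.
      - by [].
      - exact: same_labelT xy (same_labelC lab_t).
      - exact: same_labelT lab_s xy.
      - exact: same_labelT lab_s (same_labelT xy (same_labelC lab_t)).
    have e1 := label_unique s1 s2 t1 lab_s st.
    have e2 := label_unique s1 s2 t2 lab_s (same_labelT st lab_t).
    have e3 := label_unique s1 t1 t2 st (same_labelT st lab_t).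
    rewrite [s]surjective_pairing [t]surjective_pairing.
    by case: e1 e2 e3 => ? [] ? [] ?; congr pair; lia.
  have ne x y : x = s.1 \/ x = s.2 -> y = t.1 \/ y = t.2 -> x <> y.
    by move=> xs yt e; apply: (uniq x y) => //; rewrite e; split.
  have cross (u v : int * int) : same_label u.1 u.2 -> same_label v.1 v.2 ->
      ~ same_label u.1 v.1 -> u.1 != 0%R -> u.2 != 0%R -> v.1 != 0%R -> v.2 != 0%R ->
      (u.1 < v.1)%R -> (v.1 < u.2)%R -> ~ (u.2 < v.2)%R.
    move=> labu labv nuv u1 u2 v1 v2 lt1 lt2 lt3.
    have [gt0|le0] := EM (0 < u.1)%R.
      by have [|k] := @top_pair u.1 u.2 _ (proj2 labu); lia.
    have [lt0|ge0] := EM (v.2 < 0)%R.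
      by have [|k] := @bottom_pair v.1 v.2 _ (proj1 labv); lia.
    have [gt0'|le0'] := EM (0 < v.1)%R.
      by have [|k] := @top_pair v.1 v.2 _ (proj2 labv); lia.
    have [lt0'|ge0'] := EM (u.2 < 0)%R.
      by have [|k] := @bottom_pair u.1 u.2 _ (proj1 labu); lia.
    apply: nuv; split.
      have := @shaded_mono u.2 v.2; have := @shaded_mono v.1 u.1.
      by case: labu labv => [-> _] [-> _]; lia.
    have := @white_mono u.2 v.2; have := @white_mono v.1 u.1.
    by case: labu labv => [_ ->] [_ ->]; lia.
  have n11 := uniq s.1 t.1 (or_introl erefl) (or_introl erefl).
  have c1 := cross s t lab_s lab_t n11 s1 s2 t1 t2.
  have c2 := cross t s lab_t lab_s (fun e => n11 (same_labelC e)) t1 t2 s1 s2.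
  have ne1 := ne _ _ (or_introl erefl) (or_introl erefl).
  have ne2 := ne _ _ (or_introl erefl) (or_intror erefl).
  have ne3 := ne _ _ (or_intror erefl) (or_introl erefl).
  have ne4 := ne _ _ (or_intror erefl) (or_intror erefl).
  have [d|nd] := EM (s.2 < t.1 \/ t.2 < s.1)%R.
    by apply: Or31; apply/seteqP; split=> // z [[_ ?] [_ ?]]; lia.
  have [lt|gt] := EM (s.1 < t.1)%R.
    by apply: Or32; split; lia.
  by apply: Or33; split; lia.
- move=> z z0; have [y [y0 yz lab]] := label_exists z0.
  have [Ds|Ds] := frieze_ofP z0 y0 (fun e => yz (esym e)) lab.
    by exists (z, y); split; [|left].
  by exists (y, z); split; [|right].
- move=> [x y] /frieze_of_segment [x0 y0 xy [s w]] [_ /= gt0].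
  have [|k -> ->] := @top_pair x y _ w; first by move: xy => /=; lia.
  by exists k.
- move=> [x y] /frieze_of_segment [x0 y0 xy [s w]] [_ /= lt0].
  have [|k -> ->] := @bottom_pair x y _ s; first by move: xy => /=; lia.
  by exists k.
Qed.

End Labels.

Lemma frieze_of_id : frieze_of id_gal = unit_frieze.
Proof.
apply/esym/exhausting_sub_frieze; first exact: frieze_frieze_of.
  move=> z z0; have [gt0|lt0] := EM (0 < z)%R.
    exists (- `|z|%N%:Z, `|z|%N%:Z)%R; split; last by right => /=; lia.
    by exists `|z|%N; [lia|].
  exists (- `|z|%N%:Z, `|z|%N%:Z)%R; split; last by left => /=; lia.
  by exists `|z|%N; [lia|].
move=> _ [k k0 ->]; split; first by split=> /=; lia.
  by rewrite /= shaded_bottom shaded_top.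
by rewrite /= white_bottom white_top.
Qed.

(** The ends of the tail segments have equal labels. *)
Definition frieze_typed (n m : nat) (f : galois) :=
  forall k, 0 < k -> f (n + k).-1./2 = (m + k).-1./2 /\ la f (m + k)./2 = (n + k)./2.

Lemma of_type_frieze_of n m f : of_type n m (frieze_of f) <-> frieze_typed n m f.
Proof.
split=> [ty k k0|ty _ [k k0 ->]].
  have [|_ /= s w] := ty (- (m + k)%:Z, (n + k)%:Z)%R; first by exists k.
  by move: s w; rewrite shaded_bottom white_bottom shaded_top ?white_top //; lia.
have [s w] := ty k k0.
split; first by split=> /=; lia.
  by rewrite /= shaded_bottom shaded_top ?s //; lia.
by rewrite /= white_bottom white_top ?w //; lia.
Qed.

Lemma typed_comp n m p f g : frieze_typed n m f -> frieze_typed m p g ->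
  frieze_typed n p (comp_gal g f).
Proof.
move=> tf tg k k0; have [f1 f2] := tf k k0; have [g1 g2] := tg k k0.
by rewrite /= f1 g1 g2 f2.
Qed.

Section Composition.
Variables f g : galois.
Let D := frieze_of f.
Let E := frieze_of g.
Let conn := clos_refl_sym_trans vertex (edge E D).

(** Names of regions in the stacked diagram: shaded ones are carried down to the
    bottom by [f] and [g], white ones up to the top by their adjoints. *)
Definition vertex_label v : nat * nat :=
  match v with
  | Top p => (g (f p.-1./2), p./2)
  | Middle p => (g p.-1./2, la f p./2)
  | Bottom p => (p.-1./2, la f (la g p./2))
  end.

Lemma upper_label z : vertex_label (upper z) = (g (shaded f z), white f z).
Proof. by rewrite /upper /shaded /white; case: ifP. Qed.
Lemma lower_label z : vertex_label (lower z) = (shaded g z, la f (white g z)).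
Proof. by rewrite /lower /shaded /white; case: ifP. Qed.
Lemma outer_label z :
  vertex_label (outer z) = (shaded (comp_gal g f) z, white (comp_gal g f) z).
Proof. by rewrite /outer /shaded /white; case: ifP. Qed.

Lemma conn_label u v : conn u v -> vertex_label u = vertex_label v.
Proof.
elim=> //= [{}u {}v|x y z _ -> _ ->] //.
by case=> s [_ hs hw]; rewrite ?upper_label ?lower_label hs hw.
Qed.

Lemma conn_sym u v : conn u v -> conn v u. Proof. exact: rst_sym. Qed.
Lemma conn_trans v u w : conn u v -> conn v w -> conn u w. Proof. exact: rst_trans. Qed.

Lemma conn_upper x y : x != 0%R -> y != 0%R -> x <> y -> same_label f x y ->
  conn (upper x) (upper y).
Proof.
move=> x0 y0 xy lab; have [Ds|Ds] := frieze_ofP x0 y0 xy lab.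
  exact: rst_step (@edge_upper E D _ Ds).
exact/conn_sym/rst_step/(@edge_upper E D _ Ds).
Qed.

Lemma conn_lower x y : x != 0%R -> y != 0%R -> x <> y -> same_label g x y ->
  conn (lower x) (lower y).
Proof.
move=> x0 y0 xy lab; have [Ds|Ds] := frieze_ofP x0 y0 xy lab.
  exact: rst_step (@edge_lower E D _ Ds).
exact/conn_sym/rst_step/(@edge_lower E D _ Ds).
Qed.

Lemma upper_bottom n : upper (- n%:Z)%R = Middle n.
Proof. by rewrite /upper ifF; [congr Middle|]; lia. Qed.

Lemma lower_top n : 0 < n -> lower n%:Z%R = Middle n.
Proof. by move=> n0; rewrite /lower ifT. Qed.

(** Two neighbouring middle points bound either a shaded interval, which a cap of
    the upper frieze can close, or a white gap, which a cup of the lower frieze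
    can close. *)
Lemma conn_middle_succ p : 0 < p ->
  vertex_label (Middle p) = vertex_label (Middle p.+1) -> conn (Middle p) (Middle p.+1).
Proof.
move=> p0 [s w]; case op: (odd p).
  rewrite -!upper_bottom.
  apply: conn_upper; try lia.
  by split; rewrite ?shaded_bottom ?white_bottom //; lia.
rewrite -!lower_top //.
apply: conn_lower; try lia.
by split; rewrite ?shaded_top ?white_top //; lia.
Qed.

(** Labels are monotone along the middle line, so all the points between [p] and
    [q] have the same label, and neighbours among them are joined. *)
Lemma conn_middle p q : 0 < p -> 0 < q ->
  vertex_label (Middle p) = vertex_label (Middle q) -> conn (Middle p) (Middle q).
Proof.
wlog le_pq : p q / p <= q => [H|] p0 q0 lab.
  case/orP: (leq_total p q) => le; first exact: H.
  by apply: conn_sym; apply: H.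
move: q le_pq q0 lab; apply: (@nat_ind _ _ _ ) => [|q IH]; first lia.
rewrite leq_eqVlt => /orP [/eqP -> _ _|]; first exact: rst_refl.
rewrite ltnS => pq _ /= [s w].
have lab1 : vertex_label (Middle p) = vertex_label (Middle q).
  congr pair.
    have l1 := @ra_mono g p.-1./2 q.-1./2 ltac:(lia).
    by have l2 := @ra_mono g q.-1./2 q./2 ltac:(lia); lia.
  have l1 := @la_mono f p./2 q./2 ltac:(lia).
  by have l2 := @la_mono f q./2 (uphalf q) ltac:(lia); lia.
apply: (conn_trans (IH pq _ lab1)); first lia.
by apply: conn_middle_succ; [lia | rewrite -lab1; congr pair].
Qed.

Lemma conn_outer x : x != 0%R ->
  (exists y, [/\ y != 0%R, y <> x & conn (outer x) (outer y)]) \/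
  (exists2 p, 0 < p & conn (outer x) (Middle p)).
Proof.
move=> x0; have [gt0|lt0] := EM (0 < x)%R.
  have [y [y0 yx lab]] := label_exists f x0.
  have := conn_upper x0 y0 (fun e => yx (esym e)) lab.
  rewrite /outer {1}/upper gt0 /upper; case: ifP => [gt0y|_] c.
    by left; exists y; rewrite gt0y.
  by right; exists `|y|%N; [lia|].
have [y [y0 yx lab]] := label_exists g x0.
have := conn_lower x0 y0 (fun e => yx (esym e)) lab.
rewrite /outer {1}/lower ifF; last lia.
rewrite ifF /lower; last lia.
case: ifP => [_|lt0y] c.
  by right; exists `|y|%N; [lia|].
by left; exists y; rewrite lt0y.
Qed.

(** Paths preserve labels.  Conversely, let [x] and [y] be outer points with the
    same label.  If the edge at [x] or [y] leads to an outer point, that point has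
    the same label and must be the other one; otherwise both edges lead to the
    middle line, where equal labels suffice. *)
Lemma frieze_of_comp : frieze_comp E D = frieze_of (comp_gal g f).
Proof.
apply/seteqP; split=> [s [seg /conn_label]|s].
  by rewrite !outer_label => -[].
move=> Ds; have [seg hs hw] := Ds; split=> //.
have [s1 s2 lt_s lab] := frieze_of_segment Ds.
have other x y z : x != 0%R -> y != 0%R -> z != 0%R -> x <> y -> z <> x ->
    same_label (comp_gal g f) x y -> conn (outer x) (outer z) ->
    conn (outer x) (outer y).
  move=> x0 y0 z0 xy zx lab' c; have := conn_label c; rewrite !outer_label => -[e1 e2].
  by case: (label_unique x0 y0 z0 lab' (conj e1 e2)) => [/xy|/esym/zx|->].
have ne : s.1 <> s.2 by lia.
have [[y [y0 ys c]]|[p p0 c1]] := conn_outer s1.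
  exact: (other s.1 s.2 y).
have [[y [y0 ys c]]|[q q0 c2]] := conn_outer s2.
  apply/conn_sym/(other s.2 s.1 y) => //; exact: nesym.
apply: (conn_trans c1 (conn_trans _ (conn_sym c2))).
apply: conn_middle => //.
by rewrite -(conn_label c1) -(conn_label c2) !outer_label hs hw.
Qed.

End Composition.

(** * Every frieze of finite type comes from an adjunction *)

(** Some transversal segment has the top interval [i] on its left and the bottom
    gap [j] on its right. *)
Definition separates D i j :=
  exists q p, [/\ through D q p, 2 * i + 2 <= p & q <= 2 * j].

(** The witness is the right boundary of the shaded region of the interval [i]. *)
Lemma frieze_of_separates (f : galois) i j : f i < j <-> separates (frieze_of f) i j.
Proof.
split=> [lt_j|[q [p [[q0 p0 [/= _ s w]] ip qj]]]]; last first.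
  move: s; rewrite shaded_bottom shaded_top // => e.
  have := @ra_mono f i p.-1./2 ltac:(lia); lia.
have [|[p T]|[k ek cap]] := bottom_cases (frieze_frieze_of f) (q := 2 * f i + 2); first lia.
- exists (2 * f i + 2), p; split=> //; last lia.
  have [_ p0 [_ _]] := T; rewrite /= white_bottom white_top //.
  have := galP f i (f i).+1; have -> : (2 * f i + 2)./2 = (f i).+1 by lia.
  by lia.
- have e : k = f i by lia.
  have [_ _ /=] := cap; rewrite !white_bottom.
  have -> : (2 * k + 2)./2 = k.+1 by lia.
  have -> : (2 * k + 1)./2 = k by lia.
  have := galP f i k.+1; have := galP f i k; lia.
Qed.

Lemma frieze_of_inj f g : frieze_of f = frieze_of g -> f = g.
Proof.
move=> e; apply: galois_ext => i.
have fg j : f i < j <-> g i < j by rewrite !frieze_of_separates e.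
have := fg (f i).+1; have := fg (g i).+1; rewrite !ltnS !leqnn.
move=> [_ /(_ isT) h1] [/(_ isT) h2 _]; lia.
Qed.

(** Both adjoints are obtained from least witnesses, and each inequality of the
    adjunction says that [R i j] fails. *)
Lemma galois_of_relation (R : nat -> nat -> Prop) :
  (forall i i' j j', i' <= i -> j <= j' -> R i j -> R i' j') ->
  (forall i, ~ R i 0) -> (forall i, exists j, R i j) -> (forall j, exists i, ~ R i j) ->
  exists f : galois, forall i j, f i < j <-> R i j.
Proof.
move=> Rmono R0 exj exi.
have /choice [f fP] : forall i, exists v, forall j, v < j <-> R i j.
  move=> i; have exb : exists j, `[< R i j >] by have [j /asboolP] := exj i; exists j.
  case: (ex_minnP exb) => v /asboolP Rv minv; exists v.-1 => j.
  have v0 : 0 < v by case: v Rv {minv} => // /R0.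
  split=> [lt_j|/asboolP /minv]; last lia.
  by apply: Rmono Rv => //; lia.
have /choice [l lP] : forall j, exists v, forall i, v <= i <-> ~ R i j.
  move=> j; have exb : exists i, `[< ~ R i j >] by have [i /asboolP] := exi j; exists i.
  case: (ex_minnP exb) => v /asboolP Rv minv; exists v => i.
  split=> [le_i Ri|/asboolP /minv //].
  by apply: Rv; apply: Rmono Ri.
have lfP i j : (l j <= i) = (j <= f i).
  by apply/idP/idP; rewrite lP leqNgt -fP => /negP.
by exists (Galois lfP).
Qed.

Section Reconstruction.
Variables (D : set (int * int)) (fD : frieze D) (f : galois).
Hypothesis fP : forall i j, f i < j <-> separates D i j.

Lemma ra_eqP i i' : (forall j, separates D i j <-> separates D i' j) -> f i = f i'.
Proof.
move=> ss; have := ss (f i).+1; have := ss (f i').+1; rewrite -!fP !ltnS !leqnn.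
by move=> [_ /(_ isT) h1] [/(_ isT) h2 _]; lia.
Qed.

Lemma la_eqP j j' : (forall i, separates D i j <-> separates D i j') -> la f j = la f j'.
Proof.
move=> ss; have h i : (la f j <= i) = (la f j' <= i).
  by rewrite !galP (leqNgt j) (leqNgt j'); congr negb; apply/idP/idP => /fP /ss /fP.
have := h (la f j); have := h (la f j'); rewrite !leqnn; lia.
Qed.

Lemma la_leP i j : la f j <= i <-> ~ separates D i j.
Proof. by rewrite galP leqNgt -fP; split=> [/negP|/negP]. Qed.

(** It suffices that each segment of [D] joins points with equal labels.  No
    transversal segment shares an end with a cup or a cap, which settles those; for a
    transversal segment the parity of its ends tells which boundary of a region
    it is, and its neighbouring points supply the separating segments. *)
Lemma frieze_reconstruct : D = frieze_of f.
Proof.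
apply: exhausting_sub_frieze (frieze_frieze_of f) _ (frieze_exhausting fD) _.
move=> [a b] Ds; have seg := frieze_segment fD Ds; have [/= a0 b0 ab] := seg.
have [gt0a|le0a] := EM (0 < a)%R.
  have [k [ea eb]] := frieze_cup fD Ds (conj seg gt0a); subst a b.
  split=> //=; last by rewrite !white_top; lia.
  rewrite !shaded_top; try lia.
  have -> : (2 * k + 2).-1./2 = k by lia.
  have -> : (2 * k + 3).-1./2 = k.+1 by lia.
  apply: ra_eqP => j; split=> -[q [p [T kp qj]]]; exists q, p; split=> //; last lia.
  by have := through_cup fD T Ds; lia.
have [lt0b|ge0b] := EM (b < 0)%R.
  have [k [ea eb]] := frieze_cap fD Ds (conj seg lt0b); subst a b.
  split=> //=; first by rewrite !shaded_bottom; lia.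
  rewrite !white_bottom.
  have -> : (2 * k + 2)./2 = k.+1 by lia.
  have -> : (2 * k + 1)./2 = k by lia.
  apply: la_eqP => j; split=> -[q [p [T kp qj]]]; exists q, p; split=> //; last lia.
  by have := through_cap fD T Ds; lia.
have [q eq_a] : exists q : nat, a = (- q%:Z)%R by exists `|a|%N; lia.
have [p eq_b] : exists p : nat, b = p%:Z%R by exists `|b|%N; lia.
subst a b.
have q0 : 0 < q by lia.
have p0 : 0 < p by lia.
have T : through D q p by [].
have qp := through_odd fD T.
suff [s w] : f p.-1./2 = q.-1./2 /\ la f q./2 = p./2.
  by split=> //=; rewrite ?shaded_bottom ?shaded_top ?white_bottom ?white_top.
case op: (odd p).
- have [i ei] : exists i, p = 2 * i + 1 by exists p./2; lia.
  have [j ej] : exists j, q = 2 * j + 1 by exists q./2; lia.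
  have -> : p.-1./2 = i by lia.
  have -> : p./2 = i by lia.
  have -> : q.-1./2 = j by lia.
  have -> : q./2 = j by lia.
  split.
    have lt1 : f i < j.+1.
      apply/fP; have [|[p' T']|[k ek cap]] := bottom_cases fD (q := 2 * j + 2); first lia.
        have lt' := through_lt fD T T'.
        by exists (2 * j + 2), p'; split=> //; lia.
      by have := through_cap fD T cap; lia.
    suff : ~~ (f i < j) by lia.
    apply/negP => /fP [q' [p' [T' ip qj]]].
    by have := through_lt fD T T'; lia.
  have le1 : la f j <= i.
    apply/la_leP => -[q' [p' [T' ip qj]]].
    by have := through_lt fD T T'; lia.
  suff : ~ (0 < i /\ la f j <= i.-1) by lia.
  case=> i0 /la_leP; apply.
  have [|[q' T']|[k ek cup]] := top_cases fD (p := 2 * i); first lia.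
    have lt' := through_lt fD T' T.
    by exists q', (2 * i); split=> //; lia.
  by have := through_cup fD T cup; lia.
- have [i ei] : exists i, p = 2 * i + 2 by exists p./2.-1; lia.
  have [j ej] : exists j, q = 2 * j + 2 by exists q./2.-1; lia.
  have -> : p.-1./2 = i by lia.
  have -> : p./2 = i.+1 by lia.
  have -> : q.-1./2 = j by lia.
  have -> : q./2 = j.+1 by lia.
  split.
    have lt1 : f i < j.+1 by apply/fP; exists q, p; split=> //; lia.
    suff : ~~ (f i < j) by lia.
    apply/negP => /fP [q' [p' [T' ip qj]]].
    by have := through_lt fD T' T; lia.
  have le1 : la f j.+1 <= i.+1.
    apply/la_leP => -[q' [p' [T' ip qj]]].
    by have := through_lt fD T T'; lia.
  suff : ~ (la f j.+1 <= i) by lia.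
  by move=> /la_leP; apply; exists q, p; split=> //; lia.
Qed.

End Reconstruction.

Lemma frieze_arrowP n m D :
  frieze_arrow n m D <-> exists2 f, D = frieze_of f & frieze_typed n m f.
Proof.
split=> [[fD ty]|[f -> ty]]; last first.
  by split; [exact: frieze_frieze_of | apply/of_type_frieze_of].
have tail_tr k : 0 < k -> through D (m + k) (n + k).
  by move=> k0; split; [lia | lia | apply: ty; exists k].
have [|||| f fP] := @galois_of_relation (separates D).
- move=> i i' j j' le_i le_j [q [p [T ip qj]]].
  by exists q, p; split=> //; lia.
- by move=> i [q [p [[q0 _ _] _]]]; lia.
- move=> i; exists (m + (2 * i + 2)), (m + (2 * i + 2)), (n + (2 * i + 2)).
  by split; [apply: tail_tr; lia | lia | lia].
- move=> j; exists (n + (2 * j + 1)) => -[q [p [T ip qj]]].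
  by have := through_lt fD T (@tail_tr (2 * j + 1) ltac:(lia)); lia.
have e := frieze_reconstruct fD fP.
by exists f => //; apply/of_type_frieze_of; rewrite -e.
Qed.

Lemma frieze_laws P : frieze_category_laws P.
Proof.
split.
- by move=> n _; apply/frieze_arrowP; exists id_gal; rewrite ?frieze_of_id.
- move=> n m p D1 D2 _ _ _ /frieze_arrowP [f -> tf] /frieze_arrowP [g -> tg].
  apply/frieze_arrowP; exists (comp_gal g f); first exact: frieze_of_comp.
  exact: typed_comp tf tg.
- move=> n m D _ _ /frieze_arrowP [f -> tf]; rewrite -frieze_of_id frieze_of_comp.
  by congr frieze_of; apply: galois_ext.
- move=> n m D _ _ /frieze_arrowP [f -> tf]; rewrite -frieze_of_id frieze_of_comp.
  by congr frieze_of; apply: galois_ext.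
move=> n m p q D1 D2 D3 _ _ _ _ /frieze_arrowP [f -> _] /frieze_arrowP [g -> _].
move=> /frieze_arrowP [h -> _]; rewrite !frieze_of_comp.
by congr frieze_of; apply: galois_ext.
Qed.

(** * Terms as monotone maps *)

(** For odd indices [2n+1], [2m+1] the tail of a frieze starts with the right
    boundary of the interval [n], for even ones [2n], [2m] with its left
    boundary; the latter adds the strict bound of [typeB]. *)
Definition typeA n m (f : nat -> nat) := forall k, f (n + k) = m + k.
Definition typeB n m (f : nat -> nat) := typeA n m f /\ forall i, i < n -> f i < m.

Lemma frieze_typed_odd n m (f : galois) :
  frieze_typed (2 * n + 1) (2 * m + 1) f <-> typeA n m f.
Proof.
split=> [ty k|ty k k0].
  have [e _] := ty (2 * k + 1) ltac:(lia); move: e.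
  have -> : (2 * n + 1 + (2 * k + 1)).-1./2 = n + k by lia.
  by have -> : (2 * m + 1 + (2 * k + 1)).-1./2 = m + k by lia.
have -> : (2 * n + 1 + k).-1./2 = n + k./2 by lia.
have -> : (2 * m + 1 + k).-1./2 = m + k./2 by lia.
have -> : (2 * n + 1 + k)./2 = n + k.+1./2 by lia.
have -> : (2 * m + 1 + k)./2 = m + k.+1./2 by lia.
split; first exact: ty.
have := ty k.+1./2; have := ty k.+1./2.-1.
have := galP f (n + k.+1./2) (m + k.+1./2).
have := galP f (n + k.+1./2.-1) (m + k.+1./2); lia.
Qed.

Lemma frieze_typed_even n m (f : galois) :
  frieze_typed (2 * n) (2 * m) f <-> typeB n m f.
Proof.
split=> [ty|[ty lt_f] k k0].
  split=> [k|i lt_i].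
    have [e _] := ty (2 * k + 1) ltac:(lia); move: e.
    have -> : (2 * n + (2 * k + 1)).-1./2 = n + k by lia.
    by have -> : (2 * m + (2 * k + 1)).-1./2 = m + k by lia.
  have [_] := ty 1 isT; have := galP f i m.
  have -> : (2 * n + 1)./2 = n by lia.
  have -> : (2 * m + 1)./2 = m by lia.
  by lia.
have -> : (2 * n + k).-1./2 = n + k.-1./2 by lia.
have -> : (2 * m + k).-1./2 = m + k.-1./2 by lia.
have -> : (2 * n + k)./2 = n + k./2 by lia.
have -> : (2 * m + k)./2 = m + k./2 by lia.
split; first exact: ty.
have t1 := ty k./2; have t2 := ty k./2.-1.
have g1 := galP f (n + k./2) (m + k./2).
have g2 := galP f (n + k./2).-1 (m + k./2).
have [e|ne] := EM (k./2 = 0).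
  have [n0|n0] := EM (n = 0); first lia.
  have := lt_f n.-1 ltac:(lia); rewrite e !addn0 in g1 g2 t1 *; lia.
have e : (n + k./2).-1 = n + k./2.-1 by lia.
rewrite e in g2; lia.
Qed.

Fact codeg_galP n i j : (bump n.+1 j <= i) = (j <= unbump n i).
Proof. by rewrite /bump /unbump; lia. Qed.
(** The codegeneracy, which takes the value [n] at both [n] and [n.+1]. *)
Definition codeg n := Galois (codeg_galP n).

Fact coface_galP n i j : (unbump n j <= i) = (j <= bump n i).
Proof. by rewrite /bump /unbump; lia. Qed.
(** The coface, which omits the value [n]. *)
Definition coface n := Galois (coface_galP n).

(** The common shape of adding a cup or a cap: outside the tail the labels do not
    change, and the new segment and the new tail exhaust the remaining points. *)
Lemma frieze_of_patch N M N' M' c f f' :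
  frieze_typed N M f -> frieze_typed N' M' f' -> frieze_of f' c ->
  (forall z, z != 0%R -> (- M%:Z <= z <= N%:Z)%R ->
     shaded f' z = shaded f z /\ white f' z = white f z) ->
  (forall z, z != 0%R ->
     [\/ (- M%:Z <= z <= N%:Z)%R, z = c.1 \/ z = c.2, (N'%:Z < z)%R | (z < - M'%:Z)%R]) ->
  ((frieze_of f `\` tail N M) `|` [set c] `|` tail N' M')%classic = frieze_of f'.
Proof.
move=> ty ty' fc agree cover; have fD := frieze_frieze_of f.
have tyD := (of_type_frieze_of N M f).2 ty.
apply: (exhausting_sub_frieze (frieze_frieze_of f')).
- move=> z z0; case: (cover z z0) => [bd|zc|lt|gt].
  + have [s [Ds zs]] := frieze_exhausting fD z0; exists s; split=> //.
    by left; left; split=> // -[k k0 e]; move: zs; rewrite e /=; lia.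
  + by exists c; split=> //; left; right.
  + have [k [k0 ek]] : exists k, 0 < k /\ z = (N' + k)%:Z%R.
      by exists (`|z|%N - N'); lia.
    exists (- (M' + k)%:Z, (N' + k)%:Z)%R; split; last by right.
    by right; exists k.
  + have [k [k0 ek]] : exists k, 0 < k /\ z = (- (M' + k)%:Z)%R.
      by exists (`|z|%N - M'); lia.
    exists (- (M' + k)%:Z, (N' + k)%:Z)%R; split; last by left.
    by right; exists k.
- move=> s [[[Ds ntail]|-> //]|ts]; last exact: (of_type_frieze_of N' M' f').2.
  have tail_end k : 0 < k -> s.1 <> (- (M + k)%:Z)%R /\ s.2 <> (N + k)%:Z%R.
    move=> k0; have Dk : frieze_of f (- (M + k)%:Z, (N + k)%:Z)%R by apply: tyD; exists k.
    split=> e; apply: ntail; exists k => //; apply: (frieze_end_unique fD Ds Dk) => //=.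
      by left.
    by right; right; right.
  have [seg hs hw] := Ds; have [s1 s2 lt_s] := seg.
  have b1 : (- M%:Z <= s.1)%R.
    have := tail_end (`|s.1|%N - M); lia.
  have b2 : (s.2 <= N%:Z)%R.
    have := tail_end (`|s.2|%N - N); lia.
  have [e1 e1'] := agree s.1 s1 ltac:(lia).
  have [e2 e2'] := agree s.2 s2 ltac:(lia).
  by split; rewrite ?e1 ?e1' ?e2 ?e2'.
Qed.

Lemma typeA_codeg n m (f : galois) : typeA n m f -> typeA n.+1 m (comp_gal f (codeg n)).
Proof. by move=> ty k /=; rewrite -ty; congr (f _); rewrite /unbump; lia. Qed.

Lemma typeB_coface n m (f : galois) : typeB n m f -> typeB n m.+1 (comp_gal (coface m) f).
Proof.
move=> [ty lt_f]; split=> [k|i /lt_f] /=; last by rewrite /bump; lia.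
by rewrite ty /bump; lia.
Qed.

Lemma add_cup_frieze_of n m (f : galois) : typeA n m f ->
  add_cup (2 * n + 1) (2 * m + 1) (frieze_of f) = frieze_of (comp_gal f (codeg n)).
Proof.
move=> ty; apply: frieze_of_patch.
- exact/frieze_typed_odd.
- have -> : 2 * n + 1 + 2 = 2 * n.+1 + 1 by lia.
  exact/frieze_typed_odd/typeA_codeg.
- split; first by split=> /=; lia.
    rewrite /= !shaded_top /=; try lia.
    by congr (f _); rewrite /unbump; lia.
  by rewrite /= !white_top; lia.
- move=> z z0 bd; rewrite /shaded /white; case: ifP => gt0 /=; split=> //.
    by congr (f _); rewrite /unbump; lia.
  have := galP f n `|z|./2; have := ty 0; rewrite /bump addn0; lia.
- move=> z z0 /=.
  have [h|h] := EM (- (2 * m + 1)%:Z <= z <= (2 * n + 1)%:Z)%R; first exact: Or41.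
  have [h'|h'] := EM (z < 0)%R; first by apply: Or44; lia.
  have [h2|h2] := EM ((2 * n + 1 + 2)%:Z < z)%R; first exact: Or43.
  by apply: Or42; lia.
Qed.

Lemma add_cap_frieze_of n m (f : galois) : typeB n m f ->
  add_cap (2 * n) (2 * m) (frieze_of f) = frieze_of (comp_gal (coface m) f).
Proof.
move=> ty; have [_ lt_f] := ty; apply: frieze_of_patch.
- exact/frieze_typed_even.
- have -> : 2 * m + 2 = 2 * m.+1 by lia.
  exact/frieze_typed_even/typeB_coface.
- split; first by split=> /=; lia.
    by rewrite /= !shaded_bottom; lia.
  rewrite /= !white_bottom /=; congr (la f _); rewrite /unbump; lia.
- move=> z z0 bd; rewrite /shaded /white; case: ifP => gt0 /=; split=> //.
    have := lt_f `|z|.-1./2; rewrite /bump; lia.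
  by congr (la f _); rewrite /unbump; lia.
- move=> z z0 /=.
  have [h|h] := EM (- (2 * m)%:Z <= z <= (2 * n)%:Z)%R; first exact: Or41.
  have [h'|h'] := EM (0 < z)%R; first by apply: Or43; lia.
  have [h2|h2] := EM (z < - (2 * m + 2)%:Z)%R; first exact: Or44.
  by apply: Or42; lia.
Qed.

Fixpoint rankA (a : obA) : nat := let: F b := a in rankB b
with rankB (b : obB) : nat := if b is G a then (rankA a).+1 else 0.

Fixpoint lenA_rank (a : obA) : lenA a = 2 * rankA a + 1
with lenB_rank (b : obB) : lenB b = 2 * rankB b.
Proof.
- by case: a => b /=; rewrite lenB_rank addn1.
- by case: b => [|a] //=; rewrite lenA_rank; lia.
Qed.

(** The map whose frieze is [friezeA f]. *)
Fixpoint evA a1 a2 (f : termA a1 a2) : galois :=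
  match f with
  | idA _ => id_gal
  | compA _ _ _ f2 f1 => comp_gal (evA f2) (evA f1)
  | Fmap _ _ g => evB g
  | phi a1 _ f => comp_gal (evA f) (codeg (rankA a1))
  end
with evB b1 b2 (g : termB b1 b2) : galois :=
  match g with
  | idB _ => id_gal
  | compB _ _ _ g2 g1 => comp_gal (evB g2) (evB g1)
  | Gmap _ _ f => evA f
  | gamma _ b2 g => comp_gal (coface (rankB b2)) (evB g)
  end.

Scheme termA_mutind := Induction for termA Sort Prop
  with termB_mutind := Induction for termB Sort Prop.
Combined Scheme term_mutind from termA_mutind, termB_mutind.

Scheme eqA_mutind := Minimality for eqA Sort Prop
  with eqB_mutind := Minimality for eqB Sort Prop.
Combined Scheme eq_mutind from eqA_mutind, eqB_mutind.

Lemma typeA_typeB n m (f : galois) : typeA n m f -> typeB n.+1 m.+1 f.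
Proof.
move=> ty; split=> [k|i lt_i]; first by rewrite !addSnnS ty.
by have := ty 0; have := @ra_mono f i n lt_i; rewrite !addn0; lia.
Qed.

Lemma ev_typed :
  (forall a1 a2 (f : termA a1 a2), typeA (rankA a1) (rankA a2) (evA f)) /\
  (forall b1 b2 (g : termB b1 b2), typeB (rankB b1) (rankB b2) (evB g)).
Proof.
apply: term_mutind => //=.
- by move=> a1 a2 a3 f2 ty2 f1 ty1 k /=; rewrite ty1 ty2.
- by move=> b1 b2 g [].
- by move=> a1 a2 f; apply: typeA_codeg.
- by move=> b1 b2 b3 g2 [ty2 lt2] g1 [ty1 lt1]; split=> [k|i /lt1/lt2] //=; rewrite ty1 ty2.
- by move=> a1 a2 f; apply: typeA_typeB.
- by move=> b1 b2 g; apply: typeB_coface.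
Qed.

Lemma evA_typed a1 a2 (f : termA a1 a2) : typeA (rankA a1) (rankA a2) (evA f).
Proof. exact: ev_typed.1. Qed.
Lemma evB_typed b1 b2 (g : termB b1 b2) : typeB (rankB b1) (rankB b2) (evB g).
Proof. exact: ev_typed.2. Qed.

(** Only four equations are not immediate: the naturality of codegeneracies and
    of cofaces, which uses the types of the maps, and the two triangular
    equations, which say that a codegeneracy cancels both adjacent cofaces. *)
Lemma ev_eq :
  (forall a1 a2 (f f' : termA a1 a2), eqA f f' -> evA f = evA f') /\
  (forall b1 b2 (g g' : termB b1 b2), eqB g g' -> evB g = evB g').
Proof.
apply: eq_mutind => //=; try by move=> *; congruence.
all: try by move=> *; apply: galois_ext.
- move=> a1 a2 a3 f2 f1; apply: galois_ext => i /=; congr (evA f2 _).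
  have ty := evA_typed f1.
  have [lt_i|ge_i] := ltnP (rankA a1) i.
    have -> : i = rankA a1 + (i - rankA a1) by lia.
    have e k : 0 < k -> unbump (rankA a1) (rankA a1 + k) = rankA a1 + k.-1.
      by rewrite /unbump; lia.
    rewrite ty e; last lia.
    by rewrite ty /unbump; lia.
  have := @ra_mono (evA f1) _ _ ge_i; have := ty 0; rewrite !addn0 => e le_i.
  have -> : unbump (rankA a1) i = i by rewrite /unbump; lia.
  by rewrite /unbump; lia.
- move=> b1 b2 a f g; apply: galois_ext => i /=; congr (evA f _).
  by rewrite /bump /unbump; lia.
- move=> b1 b2 b3 g2 g1; apply: galois_ext => i /=.
  have [ty lt_g] := evB_typed g2; move: (evB g1 i) => j.
  have [lt_j|ge_j] := ltnP j (rankB b2).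
    have -> : bump (rankB b2) j = j by rewrite /bump; lia.
    by have := lt_g j lt_j; rewrite /bump; lia.
  have -> : bump (rankB b2) j = rankB b2 + (j - rankB b2).+1 by rewrite /bump; lia.
  have -> : evB g2 j = rankB b3 + (j - rankB b2) by rewrite -ty; congr (evB g2 _); lia.
  by rewrite ty /bump; lia.
- move=> b a1 a2 f g; apply: galois_ext => i /=; congr (evA f _).
  by rewrite /bump /unbump; lia.
Qed.

Lemma frieze_ev :
  (forall a1 a2 (f : termA a1 a2), friezeA f = frieze_of (evA f)) /\
  (forall b1 b2 (g : termB b1 b2), friezeB g = frieze_of (evB g)).
Proof.
apply: term_mutind => //=; rewrite ?frieze_of_id //.
- by move=> a1 a2 a3 f2 -> f1 ->; apply: frieze_of_comp.
- by move=> a1 a2 f ->; rewrite !lenA_rank; apply/add_cup_frieze_of/evA_typed.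
- by move=> b1 b2 b3 g2 -> g1 ->; apply: frieze_of_comp.
- by move=> b1 b2 g ->; rewrite !lenB_rank; apply/add_cap_frieze_of/evB_typed.
Qed.

Lemma well_defined : friezes_well_defined.
Proof.
split.
- move=> a1 a2 f; apply/frieze_arrowP; exists (evA f); first exact: frieze_ev.1.
  rewrite !lenA_rank; apply/frieze_typed_odd/evA_typed.
- move=> b1 b2 g; apply/frieze_arrowP; exists (evB g); first exact: frieze_ev.2.
  rewrite !lenB_rank; apply/frieze_typed_even/evB_typed.
- by move=> a1 a2 f f' /ev_eq.1 e; rewrite !frieze_ev.1 e.
- by move=> b1 b2 g g' /ev_eq.2 e; rewrite !frieze_ev.2 e.
Qed.

(** * Normal forms *)

(** Terms without composition whose only identity is that of the initial word. *)
Inductive normA : forall a1 a2, termA a1 a2 -> Prop :=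
| normA_Fmap b1 b2 (g : termB b1 b2) : normB g -> normA (Fmap g)
| normA_phi a1 a2 (f : termA a1 a2) : normA f -> normA (phi f)
with normB : forall b1 b2, termB b1 b2 -> Prop :=
| normB_Empty : normB (idB Empty)
| normB_Gmap a1 a2 (f : termA a1 a2) : normA f -> normB (Gmap f)
| normB_gamma b1 b2 (g : termB b1 b2) : normB g -> normB (gamma g).

Scheme normA_mutind := Induction for normA Sort Prop
  with normB_mutind := Induction for normB Sort Prop.
Combined Scheme norm_mutind from normA_mutind, normB_mutind.

Fixpoint sizeA a1 a2 (f : termA a1 a2) : nat :=
  match f with
  | idA _ => 1
  | compA _ _ _ f2 f1 => (sizeA f2 + sizeA f1).+1
  | Fmap _ _ g => (sizeB g).+1
  | phi _ _ f => (sizeA f).+1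
  end
with sizeB b1 b2 (g : termB b1 b2) : nat :=
  match g with
  | idB _ => 1
  | compB _ _ _ g2 g1 => (sizeB g2 + sizeB g1).+1
  | Gmap _ _ f => (sizeA f).+1
  | gamma _ _ g => (sizeB g).+1
  end.

Definition normalizableA a1 a2 (f : termA a1 a2) := exists2 h, normA h & eqA f h.
Definition normalizableB b1 b2 (g : termB b1 b2) := exists2 h, normB h & eqB g h.

(** Cut elimination: each equation of the adjunction with a composition on its
    left turns a composite of normal terms into a composite of smaller ones. *)
Lemma norm_comp n :
  (forall a1 a2 a3 (f2 : termA a2 a3) (f1 : termA a1 a2),
     normA f2 -> normA f1 -> sizeA f2 + sizeA f1 < n -> normalizableA (compA f2 f1)) /\
  (forall b1 b2 b3 (g2 : termB b2 b3) (g1 : termB b1 b2),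
     normB g2 -> normB g1 -> sizeB g2 + sizeB g1 < n -> normalizableB (compB g2 g1)).
Proof.
elim: n => [|n [IHA IHB]]; first by split.
split.
- move=> a1 a2 a3 f2 f1 nf2 nf1 lt_n.
  dependent destruction nf1.
    dependent destruction nf2.
      have [h nh e] := IHB _ _ _ g g0
        ltac:(assumption) ltac:(assumption) ltac:(move: lt_n => /=; lia).
      exists (Fmap h); first by constructor.
      exact: eqA_trans (eqA_F_comp _ _) (eqA_Fmap e).
    dependent destruction H.
      have [h nh e] := IHA _ _ _ f f0
        ltac:(assumption) ltac:(assumption) ltac:(move: lt_n => /=; lia).
      exists (phi h); first by constructor.
      exact: eqA_trans (eqA_phi_FG _ _) (eqA_phi e).
    have [h nh e] := IHA _ _ _ f (Fmap g0)
        ltac:(assumption) ltac:(by constructor) ltac:(move: lt_n => /=; lia).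
    by exists h => //; apply: eqA_trans (eqA_phi_gamma _ _) e.
  have [h nh e] := IHA _ _ _ f2 f
        ltac:(assumption) ltac:(assumption) ltac:(move: lt_n => /=; lia).
  exists (phi h); first by constructor.
  exact: eqA_trans (eqA_comp_phi _ _) (eqA_phi e).
move=> b1 b2 b3 g2 g1 ng2 ng1 lt_n.
dependent destruction ng2.
- by exists g1 => //; apply: eqB_idl.
- dependent destruction ng1.
    have [h nh e] := IHA _ _ _ f f0
        ltac:(assumption) ltac:(assumption) ltac:(move: lt_n => /=; lia).
    exists (Gmap h); first by constructor.
    exact: eqB_trans (eqB_G_comp _ _) (eqB_Gmap e).
  dependent destruction H.
    have [h nh e] := IHB _ _ _ g0 g
        ltac:(assumption) ltac:(assumption) ltac:(move: lt_n => /=; lia).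
    exists (gamma h); first by constructor.
    exact: eqB_trans (eqB_GF_gamma _ _) (eqB_gamma e).
  have [h nh e] := IHB _ _ _ (Gmap f0) g
        ltac:(by constructor) ltac:(assumption) ltac:(move: lt_n => /=; lia).
  by exists h => //; apply: eqB_trans (eqB_phi_gamma _ _) e.
have [h nh e] := IHB _ _ _ g g1
        ltac:(assumption) ltac:(assumption) ltac:(move: lt_n => /=; lia).
exists (gamma h); first by constructor.
exact: eqB_trans (eqB_gamma_comp _ _) (eqB_gamma e).
Qed.

Fixpoint norm_idA a : normalizableA (idA a)
with norm_idB b : normalizableB (idB b).
Proof.
- case: a => b; have [h nh e] := norm_idB b; exists (Fmap h); first by constructor.
  exact: eqA_trans (eqA_sym (eqA_F_id b)) (eqA_Fmap e).
case: b => [|a]; first by exists (idB Empty); constructor.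
have [h nh e] := norm_idA a; exists (Gmap h); first by constructor.
exact: eqB_trans (eqB_sym (eqB_G_id a)) (eqB_Gmap e).
Qed.

Lemma normalize :
  (forall a1 a2 (f : termA a1 a2), normalizableA f) /\
  (forall b1 b2 (g : termB b1 b2), normalizableB g).
Proof.
apply: term_mutind.
- exact: norm_idA.
- move=> a1 a2 a3 f2 [h2 n2 e2] f1 [h1 n1 e1].
  have [h nh e] := (norm_comp _).1 _ _ _ h2 h1 n2 n1 (leqnn _).
  by exists h => //; apply: eqA_trans (eqA_comp e2 e1) e.
- by move=> b1 b2 g [h nh e]; exists (Fmap h); constructor.
- by move=> a1 a2 f [h nh e]; exists (phi h); constructor.
- exact: norm_idB.
- move=> b1 b2 b3 g2 [h2 n2 e2] g1 [h1 n1 e1].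
  have [h nh e] := (norm_comp _).2 _ _ _ h2 h1 n2 n1 (leqnn _).
  by exists h => //; apply: eqB_trans (eqB_comp e2 e1) e.
- by move=> a1 a2 f [h nh e]; exists (Gmap h); constructor.
- by move=> b1 b2 g [h nh e]; exists (gamma h); constructor.
Qed.

Lemma comp_codeg_inj n (f g : galois) :
  comp_gal f (codeg n) = comp_gal g (codeg n) -> f = g.
Proof.
move=> e; apply: galois_ext => i.
have /= := congr1 (fun h : galois => h (bump n i)) e.
by have -> : unbump n (bump n i) = i by rewrite /bump /unbump; lia.
Qed.

Lemma comp_coface_inj n (f g : galois) :
  comp_gal (coface n) f = comp_gal (coface n) g -> f = g.
Proof.
move=> e; apply: galois_ext => i.
have /= := congr1 (fun h : galois => h i) e.
by rewrite /bump; lia.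
Qed.

(** The left side takes the same value at [rankA a1] and its successor, where the
    right side is separated by the strict bound of its type. *)
Lemma phi_neq_Fmap a1 b2 (f : termA a1 (F b2)) (g : termB (G a1) b2) :
  evA (phi f) <> evA (Fmap g).
Proof.
move=> /= e; have [ty lt_g] := evB_typed g.
have := lt_g (rankA a1) (ltnSn _); have := ty 0; rewrite -e /= !addn0.
have -> : unbump (rankA a1) (rankA a1).+1 = rankA a1 by rewrite /unbump; lia.
have -> : unbump (rankA a1) (rankA a1) = rankA a1 by rewrite /unbump; lia.
by lia.
Qed.

(** The value [rankB b2] is omitted on the left side only. *)
Lemma gamma_neq_Gmap a1 b2 (g : termB (G a1) b2) (f : termA a1 (F b2)) :
  evB (gamma g) <> evB (Gmap f).
Proof.
move=> /= e; have := evA_typed f 0; rewrite -e /= /bump; lia.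
Qed.

(** The outermost constructor of a normal term is determined by its map, and it
    can be cancelled since codegeneracies are epi and cofaces mono. *)
Lemma norm_inj :
  (forall a1 a2 (f : termA a1 a2), normA f ->
     forall f', normA f' -> evA f = evA f' -> f = f') /\
  (forall b1 b2 (g : termB b1 b2), normB g ->
     forall g', normB g' -> evB g = evB g' -> g = g').
Proof.
apply: norm_mutind.
- move=> b1 b2 g ng IH f' nf'; dependent destruction nf'.
    by move=> /= /IH ->.
  by move=> /esym /phi_neq_Fmap.
- move=> a1 a2 f nf IH f' nf'; dependent destruction nf'.
    by move=> /phi_neq_Fmap.
  by move=> /= /comp_codeg_inj /IH ->.
- by move=> g' ng'; dependent destruction ng'.
- move=> a1 a2 f nf IH g' ng'; dependent destruction ng'.
    by move=> /= /IH ->.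
  by move=> /esym /gamma_neq_Gmap.
- move=> b1 b2 g ng IH g' ng'; dependent destruction ng'.
    by move=> /gamma_neq_Gmap.
  by move=> /= /comp_coface_inj /IH ->.
Qed.

Lemma evA_faithful a1 a2 (f f' : termA a1 a2) : evA f = evA f' -> eqA f f'.
Proof.
have [h nh e] := normalize.1 _ _ f; have [h' nh' e'] := normalize.1 _ _ f'.
rewrite (ev_eq.1 _ _ _ _ e) (ev_eq.1 _ _ _ _ e') => /(norm_inj.1 _ _ _ nh _ nh') eh.
by apply: eqA_trans e _; rewrite eh; apply: eqA_sym.
Qed.

Lemma evB_faithful b1 b2 (g g' : termB b1 b2) : evB g = evB g' -> eqB g g'.
Proof.
have [h nh e] := normalize.2 _ _ g; have [h' nh' e'] := normalize.2 _ _ g'.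
rewrite (ev_eq.2 _ _ _ _ e) (ev_eq.2 _ _ _ _ e') => /(norm_inj.2 _ _ _ nh _ nh') eh.
by apply: eqB_trans e _; rewrite eh; apply: eqB_sym.
Qed.

(** If the map identifies the last argument before its tail with the first one in
    it, it comes from [phi]; if it omits the last value before its tail, from
    [gamma]; otherwise [Fmap] or [Gmap] applies. *)
Lemma ev_full n :
  (forall a1 a2 (h : galois), lenA a1 + lenA a2 < n ->
     typeA (rankA a1) (rankA a2) h -> exists f : termA a1 a2, evA f = h) /\
  (forall b1 b2 (h : galois), lenB b1 + lenB b2 < n ->
     typeB (rankB b1) (rankB b2) h -> exists g : termB b1 b2, evB g = h).
Proof.
elim: n => [|n [IHA IHB]]; first by split.
split.
- move=> [b1] a2 h lt_n ty.
  have viaB : (forall i, i < rankB b1 -> h i < rankA a2) ->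
      exists f : termA (F b1) a2, evA f = h.
    case: a2 lt_n ty => b2 lt_n ty lt_h.
    have [|//|g <-] := IHB b1 b2 h; first by move: lt_n => /=; lia.
    by exists (Fmap g).
  case: b1 lt_n ty viaB => [|a1] lt_n ty viaB; first exact: viaB.
  have ty0 := ty 0; rewrite !addn0 /= in ty0.
  have [lt_h|ge_h] := ltnP (h (rankA a1)) (rankA a2).
    by apply: viaB => i lt_i; have := @ra_mono h i (rankA a1) lt_i; lia.
  have eh : h (rankA a1) = rankA a2.
    by have := @ra_mono h (rankA a1) (rankA a1).+1 (leqnSn _); lia.
  have [||f ef] := IHA a1 a2 (comp_gal h (coface (rankA a1))).
  + by move: lt_n => /=; lia.
  + move=> k; rewrite -ty /=; congr (h _); rewrite /bump; lia.
  exists (phi f); rewrite /= ef; apply: galois_ext => i /=.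
  have [->|ne] := EM (i = rankA a1).
    have -> : unbump (rankA a1) (rankA a1) = rankA a1 by rewrite /unbump; lia.
    have -> : bump (rankA a1) (rankA a1) = (rankA a1).+1 by rewrite /bump; lia.
    by lia.
  by congr (h _); rewrite /unbump /bump; lia.
move=> b1 [|[b2]] h lt_n [ty lt_h].
- case: b1 lt_n ty lt_h => [|a1] lt_n ty lt_h; last by have := lt_h 0 isT.
  by exists (idB Empty); apply: galois_ext => i; rewrite (ty i).
have viaB : (forall i, i < rankB b1 -> h i < rankB b2) ->
    exists g : termB b1 (G (F b2)), evB g = h.
  move=> lt_h'; have [|| g eg] := IHB b1 b2 (comp_gal (codeg (rankB b2)) h).
  + by move: lt_n => /=; lia.
  + split=> [k|i /lt_h'] /=; last by rewrite /unbump; lia.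
    by rewrite ty /= /unbump; lia.
  exists (gamma g); rewrite /= eg; apply: galois_ext => i /=.
  have [lt_i|ge_i] := ltnP i (rankB b1).
    by have := lt_h' i lt_i; rewrite /bump /unbump; lia.
  have := ty (i - rankB b1); rewrite subnKC //= => ->.
  by rewrite /bump /unbump; lia.
case: b1 lt_n ty lt_h viaB => [|a1] lt_n ty lt_h viaB; first exact: viaB.
have [lt_h'|ge_h] := ltnP (h (rankA a1)) (rankB b2).
  by apply: viaB => i lt_i; have := @ra_mono h i (rankA a1) lt_i; lia.
have eh : h (rankA a1) = rankB b2 by have := lt_h (rankA a1) (ltnSn _) => /=; lia.
have [||f <-] := IHA a1 (F b2) h.
+ by move: lt_n => /=; lia.
+ case=> [|k]; first by rewrite !addn0 eh.
  by have := ty k; rewrite /= !addSn !addnS.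
by exists (Gmap f).
Qed.

(** * The isomorphisms of categories *)

Section FullyFaithful.
Variables (C D : category) (F : functor C D) (Finv : D -> C).
Hypothesis FK : forall a, Finv (F a) = a.
Hypothesis FinvK : forall d, F (Finv d) = d.
Hypothesis full : forall a b (g : Hom (F a) (F b)), exists f : Hom a b, fhom F f = g.
Hypothesis faithful : forall a b (f f' : Hom a b), fhom F f = fhom F f' -> f = f'.

Definition arrow_of (X : category) (a b : X) (f : Hom a b) : arrow X :=
  existT _ a (existT _ b f).

Lemma arrow_of_inj (X : category) (a b : X) (f g : Hom a b) :
  arrow_of f = arrow_of g -> f = g.
Proof. by move=> e; apply: inj_pair2 (inj_pair2 _ _ _ _ _ e). Qed.

Lemma fmap_inj : injective (fmap F).
Proof.
move=> [a [b f]] [a' [b' f']] e.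
have ea := congr1 (fun u : arrow D => Finv (projT1 u)) e.
have eb := congr1 (fun u : arrow D => Finv (projT1 (projT2 u))) e.
rewrite /= !FK in ea eb; subst a' b'.
by rewrite (faithful (arrow_of_inj e)).
Qed.

(** The equations between objects are premises so that they can be eliminated;
    for [a := Finv d1] they hold only propositionally. *)
Lemma lift_arrow a b (d1 d2 : D) (g : Hom d1 d2) : F a = d1 -> F b = d2 ->
  exists f : Hom a b, fmap F (arrow_of f) = arrow_of g.
Proof.
by move=> e1 e2; subst d1 d2; have [f <-] := full g; exists f.
Qed.

Lemma lift_comp a b c (d1 d2 d3 : D) (f : Hom a b) (g : Hom b c)
    (f' : Hom d1 d2) (g' : Hom d2 d3) : F a = d1 -> F b = d2 -> F c = d3 ->
  fmap F (arrow_of f) = arrow_of f' -> fmap F (arrow_of g) = arrow_of g' ->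
  fmap F (arrow_of (comp g f)) = arrow_of (comp g' f').
Proof.
move=> e1 e2 e3; subst d1 d2 d3 => /arrow_of_inj <- /arrow_of_inj <-.
by rewrite /= fhom_comp.
Qed.

Lemma lift_id a (d : D) : F a = d -> fmap F (arrow_of (idm a)) = arrow_of (idm d).
Proof. by move=> e; subst d; rewrite /= fhom_id. Qed.

Lemma isomorphism_of_fully_faithful : is_isomorphism F.
Proof.
pose lift d1 d2 (g : Hom d1 d2) := projT1 (cid (lift_arrow g (FinvK d1) (FinvK d2))).
have liftP d1 d2 (g : Hom d1 d2) : fmap F (arrow_of (lift _ _ g)) = arrow_of g.
  exact: projT2 (cid (lift_arrow g (FinvK d1) (FinvK d2))).
have lift1 d : lift _ _ (idm d) = idm (Finv d).
  by apply/arrow_of_inj/fmap_inj; rewrite liftP (lift_id (FinvK d)).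
have liftM d1 d2 d3 (g : Hom d2 d3) (f : Hom d1 d2) :
    lift _ _ (comp g f) = comp (lift _ _ g) (lift _ _ f).
  by apply/arrow_of_inj/fmap_inj; rewrite liftP; apply/esym/lift_comp; rewrite ?FinvK.
exists (Functor lift1 liftM); split=> //; last by move=> [d1 [d2 g]]; apply: liftP.
by move=> f; apply: fmap_inj; case: f => a [b f]; apply: liftP.
Qed.

End FullyFaithful.

Definition wordB n := iter n (fun b => G (F b)) Empty.

Fixpoint rankBK b : wordB (rankB b) = b :=
  match b with
  | Empty => erefl
  | G (F b) => congr1 (fun b => G (F b)) (rankBK b)
  end.

Lemma E_A_iso laws wd : is_isomorphism (E_A laws wd).
Proof.
apply: (@isomorphism_of_fully_faithful A (D_A laws) (E_A laws wd)
          (fun n : D_A laws => F (wordB (val n)./2))).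
- move=> [b] /=; rewrite lenB_rank; congr F; rewrite -[RHS]rankBK; congr wordB; lia.
- move=> [n odd_n]; apply: val_inj => /=; rewrite lenB_word; lia.
- move=> a1 a2 [D hD]; have /frieze_arrowP [h e ty] := hD; rewrite /= !lenA_rank in ty.
  have [|t et] := (ev_full _).1 a1 a2 h (leqnn _); first exact/frieze_typed_odd.
  exists (class_of _ _ _ t); apply: eq_exist.
  rewrite e -et -frieze_ev.1; exact: (friezeA_eq wd (repr_class_of _ _ _ _)).
- move=> a1 a2 f f' [e]; rewrite -[f]class_ofK -[f']class_ofK; apply/class_of_eq.
  by apply/evA_faithful/frieze_of_inj; rewrite -!frieze_ev.1.
Qed.

Lemma E_B_iso laws wd : is_isomorphism (E_B laws wd).
Proof.
apply: (@isomorphism_of_fully_faithful B (D_B laws) (E_B laws wd)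
          (fun n : D_B laws => wordB (val n)./2)).
- move=> b /=; rewrite lenB_rank -[RHS]rankBK; congr wordB; lia.
- move=> [n even_n]; apply: val_inj; rewrite /= lenB_word; move: even_n => /=; lia.
- move=> b1 b2 [D hD]; have /frieze_arrowP [h e ty] := hD; rewrite /= !lenB_rank in ty.
  have [|t et] := (ev_full _).2 b1 b2 h (leqnn _); first exact/frieze_typed_even.
  exists (class_of _ _ _ t); apply: eq_exist.
  rewrite e -et -frieze_ev.2; exact: (friezeB_eq wd (repr_class_of _ _ _ _)).
- move=> b1 b2 g g' [e]; rewrite -[g]class_ofK -[g']class_ofK; apply/class_of_eq.
  by apply/evB_faithful/frieze_of_inj; rewrite -!frieze_ev.2.
Qed.

Theorem mainTheorem10 :
  exists (lawsA : frieze_category_laws odd)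
         (lawsB : frieze_category_laws (predC odd))
         (wd : friezes_well_defined),
    is_isomorphism (E_A lawsA wd) /\ is_isomorphism (E_B lawsB wd).
Proof.
exists (frieze_laws odd), (frieze_laws (predC odd)), well_defined.
by split; [apply: E_A_iso | apply: E_B_iso].
Qed.
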